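(* Let $g$ be a (pseudo-)Riemannian metric on a manifold $\mathcal M$ of dimension $n$ and let $A$ be projectively compatible with $g$. For $t\in\mathbb R$ let $K_t^{ij}=\det(t\,\mathrm{Id}-A)\,\big((t\,\mathrm{Id}-A)^{-1}\big)^i_l\,g^{lj}$ and let $\hat I_t$ be the differential operator acting on functions by $\hat I_t(f)=-\nabla_j\big(K_t^{jk}\nabla_kf\big)$. Then for any pair of real numbers $(v,w)$ the operators $\hat I_v$ and $\hat I_w$ commute: $[\hat I_v,\hat I_w]=0$.
   Context: $\nabla$ is the Levi-Civita connection of $g$; indices are raised and lowered with $g$; Einstein summation convention. Projectively compatible: a $(1,1)$-tensor $A$ is projectively compatible with $g$ if $A_{ij}$ is symmetric (i.e. $A$ is $g$-self-adjoint) and $$\nabla_kA_{ij}=\lambda_i g_{jk}+\lambda_j g_{ik},\qquad \lambda=\tfrac12\operatorname{tr}A,\quad \lambda_i=\nabla_i\lambda .$$ $K_t$ is a polynomial in $t$ of degree $n-1$ (the adjugate of $t\,\mathrm{Id}-A$ with an index raised), so it is defined for all $t\in\mathbb R$. *)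

(* Defs.v *)
From HB Require Import structures.
From mathcomp Require Import all_boot all_order all_algebra.
From mathcomp Require Import all_classical all_reals all_analysis.

Set Implicit Arguments.
Unset Strict Implicit.
Unset Printing Implicit Defensive.

Import Order.TTheory GRing.Theory Num.Theory.
Import numFieldNormedType.Exports.

Local Open Scope classical_set_scope.
Local Open Scope ring_scope.

Section Calculus.
Context {R : realType} {n : nat}.
Implicit Types (u : 'rV[R]_n -> R).

Definition partial (i : 'I_n) u : 'rV[R]_n -> R := fun x => 'D_(delta_mx 0 i) u x.

Definition iter_partial (s : seq 'I_n) u : 'rV[R]_n -> R := foldr partial u s.

(* C^oo on the open set U: every iterated partial derivative exists and is
   continuous at every point of U. *)
Definition smooth_on (U : set 'rV[R]_n) u : Prop :=
  forall (s : seq 'I_n) x, U x ->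
    {for x, continuous (iter_partial s u)} /\
    forall i, derivable (iter_partial s u) x (delta_mx 0 i).

Definition smooth_mx_on m p (U : set 'rV[R]_n) (B : 'rV[R]_n -> 'M[R]_(m, p)) :
  Prop := forall i j, smooth_on U (fun x => B x i j).

End Calculus.

(* n-dimensional C^oo manifolds without boundary.  The chart a maps the open
   set dom a homeomorphically onto an open subset of R^n by coord a, with
   inverse param a; the values of coord a and param a outside these sets are
   junk. *)
Record smooth_manifold (R : realType) (n : nat) := SmoothManifold {
  carrier :> topologicalType;
  atlas : Type;
  dom : atlas -> set carrier;
  coord : atlas -> carrier -> 'rV[R]_n;
  param : atlas -> 'rV[R]_n -> carrier;
  carrier_hausdorff : hausdorff_space carrier;
  carrier_second_countable : @second_countable carrier;
  dom_open : forall a, open (dom a);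
  dom_cover : forall p, exists a, dom a p;
  image_open : forall a, open (coord a @` dom a);
  coordK : forall a p, dom a p -> param a (coord a p) = p;
  coord_continuous : forall a, {within dom a, continuous (coord a)};
  param_continuous : forall a, {within coord a @` dom a, continuous (param a)};
  transition_smooth : forall a b,
    smooth_mx_on (coord a @` (dom a `&` dom b)) (coord b \o param a)
}.

Section Fields.
Context {R : realType} {n : nat} (M : smooth_manifold R n).

Definition chart_image (a : atlas M) : set 'rV[R]_n := coord a @` dom a.

Definition overlap (a b : atlas M) : set 'rV[R]_n :=
  coord a @` (dom a `&` dom b).

Definition transition (a b : atlas M) : 'rV[R]_n -> 'rV[R]_n :=
  coord b \o param a.

Definition smooth_fun (f : M -> R) : Prop :=
  forall a : atlas M, smooth_on (chart_image a) (f \o param a).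

(* Components of a tensor field of rank 2, one matrix-valued function of the
   coordinates for each chart. *)
Definition components := atlas M -> 'rV[R]_n -> 'M[R]_n.

(* Recall that ('J F x) i j is the i-th partial derivative of the j-th
   component of F. The entry i j of g a x is g_ij. *)
Definition is_tensor02 (g : components) : Prop :=
  (forall a, smooth_mx_on (chart_image a) (g a)) /\
  forall a b x, overlap a b x ->
    let J := 'J (transition a b) x in
    g a x = J *m g b (transition a b x) *m J^T.

(* The entry i j of A a x is A^i_j. *)
Definition is_tensor11 (A : components) : Prop :=
  (forall a, smooth_mx_on (chart_image a) (A a)) /\
  forall a b x, overlap a b x ->
    let J := 'J (transition a b) x in
    J^T *m A a x = A b (transition a b x) *m J^T.

Definition pseudo_riemannian (g : components) : Prop :=
  is_tensor02 g /\
  forall a x, chart_image a x -> (g a x)^T = g a x /\ g a x \in unitmx.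

End Fields.

(* Tensor calculus in one chart; g and A are the matrices g_ij and A^i_j as
   functions of the coordinates. *)
Section Coordinates.
Context {R : realType} {n : nat}.
Implicit Types (g A B : 'rV[R]_n -> 'M[R]_n) (i j k l : 'I_n) (x : 'rV[R]_n).

(* Gamma^i_jk of the Levi-Civita connection of g *)
Definition christoffel g i j k x : R :=
  2^-1 * \sum_l invmx (g x) i l *
    (partial j (fun y => g y l k) x + partial k (fun y => g y l j) x
     - partial l (fun y => g y j k) x).

(* nabla_k V^i *)
Definition nabla_vector g (V : 'I_n -> 'rV[R]_n -> R) k i x : R :=
  partial k (V i) x + \sum_l christoffel g i k l x * V l x.

(* nabla_k B_ij *)
Definition nabla_tensor02 g B k i j x : R :=
  partial k (fun y => B y i j) x
  - \sum_l christoffel g l k i x * B x l j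
  - \sum_l christoffel g l k j x * B x i l.

(* A_ij = g_il A^l_j *)
Definition lower_index g A : 'rV[R]_n -> 'M[R]_n := fun x => g x *m A x.

Definition half_trace A : 'rV[R]_n -> R := fun x => 2^-1 * \tr (A x).

(* K_t^ij.  The adjugate of t Id - A is det(t Id - A) (t Id - A)^-1 whenever
   t is not an eigenvalue of A, and extends it polynomially to all t. *)
Definition Killing g A (t : R) : 'rV[R]_n -> 'M[R]_n :=
  fun x => \adj (t%:M - A x) *m invmx (g x).

(* - nabla_j (K_t^jk nabla_k u) *)
Definition quantum_integral_loc g A (t : R) (u : 'rV[R]_n -> R) x : R :=
  - \sum_j nabla_vector g
      (fun i y => \sum_k Killing g A t y i k * partial k u y) j j x.

End Coordinates.

Section Operators.
Context {R : realType} {n : nat} {M : smooth_manifold R n}.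

Definition projectively_compatible (g A : components M) : Prop :=
  is_tensor11 A /\
  forall a x, chart_image a x ->
    let AL := lower_index (g a) (A a) in
    let lambda_ i := partial i (half_trace (A a)) x in
    (AL x)^T = AL x /\
    forall k i j, nabla_tensor02 (g a) AL k i j x =
      lambda_ i * g a x j k + lambda_ j * g a x i k.

Definition chart_at (p : M) : atlas M := sval (cid (dom_cover p)).

(* The operator is evaluated at p in a chart around p; as its coordinate
   expression is tensorial, the choice of the chart is immaterial. *)
Definition quantum_integral (g A : components M) (t : R) (f : M -> R) : M -> R :=
  fun p => let a := chart_at p in
    quantum_integral_loc (g a) (A a) t (f \o param a) (coord a p).

Definition commutator (P Q : (M -> R) -> (M -> R)) (f : M -> R) : M -> R :=
  fun p => P (Q f) p - Q (P f) p.

End Operators.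

(* Main.v *)
(* In a chart put G = g^-1, chi_t = det(t - A) and B_t = (t - A)^-1 G, so that
   K_t = chi_t B_t wherever t - A is invertible.  Compatibility gives
   nabla_k B_t and d chi_t = - 2 chi_t g B_t lambda.  For a function f with
   differential phi and Hessian h, the 2-form
     Om = A^T h - h A + lambda phi^T - phi lambda^T
   does not depend on t, and div(K_t phi) = chi_t q_t, where q_t satisfies
     (t - A^T) dq_t - 2 q_t lambda = d(Laplacian f) - (terms linear in Om, nabla Om),
   the parameter t entering the right hand side only through B_t; this uses
   the integrability condition of the compatibility equation and the
   symmetries of the curvature.  Comparing two parameters gives
     K_v d(div(K_w phi)) - K_w d(div(K_v phi)) = div F,
     F = (w - v)^-1 chi_v chi_w (B_v - B_w) Om (B_v - B_w).
   As F is antisymmetric, div (div F) = 0, whence the commutation wherever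
   v - A and w - A are invertible.  Since K_t is polynomial in t, Lagrange
   interpolation removes this restriction. *)

From HB Require Import structures.
Require Import Defs.
From mathcomp Require Import all_boot all_order all_algebra.
From mathcomp Require Import all_classical all_reals all_analysis.
From mathcomp Require Import ring lra.

Set Implicit Arguments.
Unset Strict Implicit.
Unset Printing Implicit Defensive.

Import Order.TTheory GRing.Theory Num.Theory.
Import numFieldNormedType.Exports.

Local Open Scope classical_set_scope.
Local Open Scope ring_scope.

(** The commutator applied to f is the divergence of K_v d(div K_w df) - K_w d(div K_v df), so it
    suffices to exhibit this field as the divergence of a bivector; fourth derivatives of f and
    derivatives of the curvature are never expanded. The left side (t - A^T) dq_t - 2 q_t lambda is
    (t - A^T) / chi_t applied to d(chi_t q_t). The Laplacian drops out because, by the resolvent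
    identity B_v - B_w = (w - v) B_v g B_w, both equations get multiplied by the same matrix before
    they are subtracted. The curvature in dq_t is tamed by moving t - A through R(e_m, e_j): the
    cost is [R, A], which integrability expresses by the Hessian of lambda, and since this Hessian
    commutes with A the cross terms cancel. The given v and w may be eigenvalues of A everywhere, so
    interpolation uses nodes adapted to the point at hand, with weights that are constants and pass
    through all derivatives. Finally, the operators are read in a chart chosen point by point, so
    composing them requires invariance under changes of chart. *)

Section DirectionalCalculus.
Context {R : realType} {V : normedModType R}.
Implicit Types (u : V -> R) (x e : V) (c d s : R).

(** * Directional derivatives: mean values and symmetry of mixed derivatives *)

Lemma derivable_line u x e c :
  derivable u (c *: e + x) e -> is_derive c 1 (fun t : R => u (t *: e + x)) ('D_e u (c *: e + x)).
Proof.
have E : (fun h : R => h^-1 *: (((fun t : R => u (t *: e + x)) \o shift c) (h *: 1) - u (c *: e + x)))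
       = (fun h : R => h^-1 *: ((u \o shift (c *: e + x)) (h *: e) - u (c *: e + x))).
  by apply/funext => h /=; rewrite [h *: 1]mulr1 scalerDl addrA.
move=> du; apply: DeriveDef.
  by rewrite /derivable E.
by rewrite /derive E.
Qed.

(** The one-variable theorem on [0, s] or [s, 0]; bounding c only by |s| lets both signs of s share
    one statement. *)
Lemma mean_value_dir u x e s :
  (forall c, `|c| <= `|s| -> derivable u (c *: e + x) e) ->
  exists2 c, `|c| <= `|s| & u (s *: e + x) - u x = s * 'D_e u (c *: e + x).
Proof.
move=> du; pose f (t : R) := u (t *: e + x).
have df c : `|c| <= `|s| -> is_derive c 1 f ('D_e u (c *: e + x)).
  by move=> /du; exact: derivable_line.
have f0 : f 0 = u x by rewrite /f scale0r add0r.
have cf a b : (forall c, c \in `[a, b]%R -> `|c| <= `|s|) -> {within `[a, b], continuous f}.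
  move=> ab; apply: continuous_in_subspaceT => c /set_mem /= cab.
  have dc : derivable f c 1 by have dc := df c (ab c cab); exact: ex_derive.
  exact/differentiable_continuous/derivable1_diffP.
have [s0|s0] := leP 0 s.
  have b c : c \in `[0, s]%R -> `|c| <= `|s|.
    by rewrite in_itv /= => /andP[? ?]; rewrite !ger0_norm.
  have [|c cs E] := @MVT_segment R f (fun c => 'D_e u (c *: e + x)) _ _ s0 _ (cf _ _ b).
    by move=> c cs; apply: df; apply: b; move: cs; rewrite !in_itv /= => /andP[/ltW -> /ltW ->].
  by exists c; [exact: b|rewrite -f0 -/(f s) E subr0 mulrC].
have b c : c \in `[s, 0]%R -> `|c| <= `|s|.
  by rewrite in_itv /= => /andP[? ?]; rewrite !ler0_norm ?lerN2 // ltW.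
have [|c cs E] := @MVT_segment R f (fun c => 'D_e u (c *: e + x)) _ _ (ltW s0) _ (cf _ _ b).
  by move=> c cs; apply: df; apply: b; move: cs; rewrite !in_itv /= => /andP[/ltW -> /ltW ->].
exists c; first exact: b.
by rewrite -f0 -/(f s) -opprB E sub0r mulrN opprK mulrC.
Qed.

(* The second difference of u along (e, e') is evaluated by two mean values, in either order. *)
Lemma second_difference u x e e' s :
  (forall c d, `|c| <= `|s| -> `|d| <= `|s| ->
    derivable u (c *: e + (d *: e' + x)) e /\
    derivable ('D_e u) (c *: e + (d *: e' + x)) e') ->
  exists c d, [/\ `|c| <= `|s|, `|d| <= `|s| &
    u (s *: e + (s *: e' + x)) - u (s *: e + x) - u (s *: e' + x) + u x
    = s * s * 'D_e' ('D_e u) (c *: e + (d *: e' + x))].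
Proof.
move=> du; pose f y := u (y + s *: e') - u y.
have sE y : u (y + s *: e') = (u \o shift (s *: e')) y by [].
have dsh c : `|c| <= `|s| -> is_derive (c *: e + x) e (u \o shift (s *: e'))
    ('D_e u (c *: e + (s *: e' + x))).
  move=> cs; have [d1 _] := du c s cs (lexx _).
  have E : (fun h : R => h^-1 *: (((u \o shift (s *: e')) \o shift (c *: e + x)) (h *: e)
       - (u \o shift (s *: e')) (c *: e + x))) =
     (fun h : R => h^-1 *: ((u \o shift (c *: e + (s *: e' + x))) (h *: e)
       - u (c *: e + (s *: e' + x)))).
    by apply/funext => h /=; rewrite -!addrA ![x + _]addrC.
  by apply: DeriveDef; rewrite /derivable /derive E.
have dun c : `|c| <= `|s| -> derivable u (c *: e + x) e.
  have z : `|0 : R| <= `|s| by rewrite normr0.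
  by move=> cs; have [+ _] := du c 0 cs z; rewrite scale0r add0r.
have dfc c : `|c| <= `|s| -> is_derive (c *: e + x) e f
    ('D_e u (c *: e + (s *: e' + x)) - 'D_e u (c *: e + x)).
  move=> cs; apply: is_deriveB; first exact: dsh.
  exact/derivableP/dun.
have [|c cs Ec] := @mean_value_dir f x e s.
  by move=> c cs; have dc := dfc c cs; exact: ex_derive.
have [|d ds Ed] := @mean_value_dir ('D_e u) (c *: e + x) e' s.
  move=> d ds; rewrite addrCA; by have [] := du c d cs ds.
exists c, d; split; [exact: cs|exact: ds|].
have dc := dfc c cs; rewrite derive_val in Ec.
rewrite (addrCA (c *: e)) -mulrA -Ed (addrCA (s *: e')) -Ec /f.
rewrite (addrC x) -(addrA _ x) (addrC x) opprB addrA.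
by rewrite -[LHS]addrA (addrC (- _)).
Qed.

(** Schwarz's theorem: the same second difference, evaluated in both orders, gives two points near x
    where the two mixed derivatives agree, and continuity brings both values within eta / 2 of the
    values at x. *)
Lemma derive_comm u x e e' :
  (\forall y \near x, derivable u y e /\ derivable ('D_e u) y e') ->
  (\forall y \near x, derivable u y e' /\ derivable ('D_e' u) y e) ->
  {for x, continuous ('D_e' ('D_e u))} ->
  {for x, continuous ('D_e ('D_e' u))} ->
  'D_e' ('D_e u) x = 'D_e ('D_e' u) x.
Proof.
move=> d1 d2 c1 c2; apply/eqP; rewrite -subr_eq0 -normr_le0; apply/ler_addgt0Pr => eta eta0; rewrite add0r.
have e20 : 0 < eta / 2 by rewrite divr_gt0.
move/cvgrPdist_le: c1 => /(_ _ e20) c1; move/cvgrPdist_le: c2 => /(_ _ e20) c2.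
have [r /= r0 Hr] := (nbhs_ballP _ _).1 (filterI (filterI d1 d2) (filterI c1 c2)).
(* The summand 1 keeps the denominator positive when e = e' = 0; halving puts the whole
   parallelogram strictly inside the ball. *)
pose s := r / (`|e| + `|e'| + 1) / 2.
have D0 : 0 < `|e| + `|e'| + 1 by rewrite ltr_wpDl // addr_ge0.
have s0 : 0 < s by rewrite /s !divr_gt0.
have sn : `|s| = s by rewrite gtr0_norm.
have bs c d : `|c| <= `|s| -> `|d| <= `|s| -> ball x r (c *: e + (d *: e' + x)).
  rewrite sn => cs ds; rewrite -ball_normE /= addrA opprD addrCA subrr addr0 normrN.
  rewrite (le_lt_trans (ler_normD _ _)) // !normrZ.
  apply: (@le_lt_trans _ _ (s * (`|e| + `|e'| + 1))).
    rewrite !mulrDr mulr1 -[leLHS]addr0 lerD ?(ltW s0) // lerD // ler_wpM2r //.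
  by rewrite /s mulrAC divfK ?gt_eqF // ltr_pdivrMr // ltr_pMr // ltr1n.
have bs' c d : `|c| <= `|s| -> `|d| <= `|s| -> ball x r (d *: e' + (c *: e + x)).
  by move=> cs ds; rewrite addrCA; apply: bs.
have [|c [d [cs ds E]]] := @second_difference u x e e' s.
  by move=> c d cs ds; have [[]] := Hr _ (bs _ _ cs ds).
have [|c' [d' [cs' ds' E']]] := @second_difference u x e' e s.
  by move=> c' d' cs' ds'; have [[_ ]] := Hr _ (bs' _ _ ds' cs').
have EE : 'D_e' ('D_e u) (c *: e + (d *: e' + x)) = 'D_e ('D_e' u) (c' *: e' + (d' *: e + x)).
  have ss : s * s != 0 by rewrite mulf_neq0 ?gt_eqF.
  apply: (mulfI ss); apply: etrans (etrans _ E'); first exact: esym E.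
  rewrite (addrCA (s *: e') (s *: e) x).
  by congr (_ + _); rewrite addrAC.
have [_ [h1 _]] := Hr _ (bs _ _ cs ds).
have [_ [_ h2]] := Hr _ (bs' _ _ ds' cs').
rewrite /= in h1 h2.
apply: le_trans (ler_distD ('D_e' ('D_e u) (c *: e + (d *: e' + x))) _ _) _.
rewrite (splitr eta); apply: lerD; first exact: h1.
by rewrite EE distrC; exact: h2.
Qed.

End DirectionalCalculus.

(** * Continuous partial derivatives imply total differentiability *)

Section TotalDerivative.
Context {R : realType} {n : nat}.
Implicit Types (u : 'rV[R]_n -> R) (x : 'rV[R]_n).

Lemma differentiable_littleo (V W : normedModType R) (f : V -> W) (df : {linear V -> W}) (x : V) :
  continuous df -> f \o shift x = cst (f x) + df +o_ 0 id -> differentiable f x.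
Proof.
move=> dfc dxf; apply/diff_locallyP.
by rewrite (diff_unique dfc dxf).
Qed.

(** The vertices of the path from 0 to h that switches on one coordinate at a time. *)
Definition truncate (k : nat) (h : 'rV[R]_n) : 'rV[R]_n := \row_j (if (j < k)%N then h 0 j else 0).

Lemma norm_entry_le (h : 'rV[R]_n) j : `|h 0 j| <= `|h|.
Proof.
rewrite [leRHS]/Num.Def.normr/= mx_normrE.
exact: (le_bigmax _ (fun ij : 'I_1 * 'I_n => `|h ij.1 ij.2|) (0, j)).
Qed.

Lemma norm_row_le (h : 'rV[R]_n) (r : R) : 0 <= r -> (forall j, `|h 0 j| <= r) -> `|h| <= r.
Proof.
move=> r0 hr; rewrite [leLHS]/Num.Def.normr/= mx_normrE.
by apply: bigmax_le => // -[i j] _ /=; rewrite (ord1 i).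
Qed.

(** Telescoping along the truncations of h: each edge is parallel to a basis vector, so the mean
    value theorem bounds its error by eps times |h|, and there are n edges. *)
Lemma partial_increment u x (h : 'rV[R]_n) (a : 'I_n -> R) (eps : R) :
  0 <= eps ->
  (forall y, `|y| <= `|h| -> forall i, derivable u (y + x) (delta_mx 0 i) /\
     `|partial i u (y + x) - a i| <= eps) ->
  `|u (h + x) - u x - \sum_i h 0 i * a i| <= eps * n%:R * `|h|.
Proof.
move=> eps0 du.
have T k (kn : (k < n)%N) :
  truncate k.+1 h = h 0 (Ordinal kn) *: delta_mx 0 (Ordinal kn) + truncate k h.
  apply/rowP => j; rewrite !mxE eqxx /= ltnS.
  have [->|jk] := eqVneq j (Ordinal kn); first by rewrite leqnn ltnn mulr1 addr0.
  by rewrite leq_eqVlt -(inj_eq val_inj) /= in jk *; rewrite (negbTE jk) mulr0 add0r.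
have S k : (k <= n)%N ->
   `|u (truncate k h + x) - u x - \sum_(i < n | (i < k)%N) h 0 i * a i| <= eps * k%:R * `|h|.
  elim: k => [_|k IH kn].
    have -> : truncate 0 h = 0 by apply/rowP => j; rewrite !mxE.
    by rewrite add0r subrr big_pred0 // subr0 normr0 mulr0 mul0r.
  pose i := Ordinal kn.
  (* The norm on rows is the maximum norm, so no point of an edge is longer than h. *)
  have bnd c : `|c| <= `|h 0 i| -> `|c *: delta_mx 0 i + truncate k h| <= `|h|.
    move=> ch; apply: norm_row_le => // j; rewrite !mxE eqxx /=.
    have [->|ji] := eqVneq j i.
      by rewrite /= ltnn mulr1 addr0 (le_trans ch) ?norm_entry_le.
    rewrite mulr0 add0r; case: ifP => _; rewrite ?normr0 //; exact: norm_entry_le.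
  have [c ch E] := @mean_value_dir _ _ u (truncate k h + x) (delta_mx 0 i) (h 0 i)
     (fun c ch => eq_ind_r (fun z => derivable u z _) (du _ (bnd c ch) i).1 (addrA _ _ _)).
  have := (du _ (bnd c ch) i).2; rewrite -addrA => dui.
  rewrite (bigD1 i) //= (T _ kn) -/i -(addrA (h 0 i *: _)).
  have -> : \sum_(j < n | (j < k.+1)%N && (j != i)) h 0 j * a j = \sum_(j < n | (j < k)%N) h 0 j * a j.
    by apply: eq_bigl => j; rewrite -(inj_eq val_inj) /= ltnS andbC -ltn_neqAle.
  have {}IH := IH (ltnW kn).
  set s := \sum_(j < n | _) _ in IH *; set A := u (_ + (_ + x)) in E *.
  set B := u (truncate k h + x) in E IH *; set C := u x in IH *.
  rewrite -/(partial i u _) in E; set d := partial i u _ in E dui.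
  have -> : A - C - (h 0 i * a i + s) = h 0 i * (d - a i) + (B - C - s).
    by rewrite mulrBr -E; ring.
  have -> : eps * k.+1%:R * `|h| = eps * `|h| + eps * k%:R * `|h|.
    by rewrite -natr1; move: `|h| k%:R => q r; ring.
  apply: le_trans (ler_normD _ _) _; apply: lerD; last exact: IH.
  by rewrite normrM mulrC ler_pM // norm_entry_le.
have := S n (leqnn n).
have -> : truncate n h = h by apply/rowP => j; rewrite !mxE ltn_ord.
by congr (`|_ - _| <= _); apply: eq_bigl => i; rewrite ltn_ord.
Qed.

Definition row_form (a : 'I_n -> R) : 'rV[R]_n -> R := fun h => \sum_i h 0 i * a i.

Lemma row_form_is_linear a : linear (row_form a).
Proof.
move=> k h h'; rewrite /row_form scaler_sumr -big_split /=; apply: eq_bigr => i _.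
by rewrite !mxE mulrDl scalerAl.
Qed.

HB.instance Definition _ a := GRing.isLinear.Build R 'rV[R]_n R _ (row_form a) (row_form_is_linear a).

Lemma row_form_continuous a : continuous (row_form a).
Proof.
suff cs s : continuous (fun h : 'rV[R]_n => \sum_(i <- s) h 0 i * a i) by exact: cs.
elim: s => [|i s IH] x.
  have -> : (fun h : 'rV[R]_n => \sum_(i <- [::]) h 0 i * a i) = cst 0.
    by apply/funext => h; rewrite big_nil.
  exact: cst_continuous.
have -> : (fun h : 'rV[R]_n => \sum_(j <- i :: s) h 0 j * a j) =
    (fun h : 'rV[R]_n => h 0 i * a i) \+ (fun h : 'rV[R]_n => \sum_(j <- s) h 0 j * a j).
  by apply/funext => h; rewrite big_cons.
have h1 : {for x, continuous (fun h : 'rV[R]_n => h 0 i * a i)}.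
  apply: differentiable_continuous.
  apply: (@differentiableM _ _ (fun h : 'rV[R]_n => h 0 i) (cst (a i))) => //.
  exact: differentiable_coord.
exact: (cvgD h1 (IH x)).
Qed.

Lemma C1_differentiable u x :
  (\forall y \near x, forall i, derivable u y (delta_mx 0 i)) ->
  (forall i, {for x, continuous (partial i u)}) ->
  differentiable u x.
Proof.
move=> du cu; apply: (@differentiable_littleo _ _ u (row_form (fun i => partial i u x))).
  exact: row_form_continuous.
apply/eqaddoP => e e0.
(* The increment bound loses a factor n; adding 1 covers n = 0. *)
pose eps := e / (n%:R + 1).
have n1 : 0 < n%:R + 1 :> R by rewrite ltr_wpDl.
have eps0 : 0 < eps by rewrite divr_gt0.
have cu' : \forall y \near x, forall i, `|partial i u y - partial i u x| <= eps.
  apply: (@filter_forall _ _ (fun i => [set y | `|partial i u y - partial i u x| <= eps]) _ (nbhs_filter x)) => i /=; have /cvgrPdist_le /(_ _ eps0) := cu i.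
  by apply: filterS => y; rewrite distrC.
have [r /= r0 Hr] := (nbhs_ballP _ _).1 (filterI du cu').
apply/nbhs_ballP; exists r => // h /=; rewrite -ball_normE /= sub0r normrN => hr.
have H : `|u (h + x) - u x - row_form (fun i => partial i u x) h| <= eps * n%:R * `|h|.
  apply: (@partial_increment u x h (fun i => partial i u x) eps (ltW eps0)) => y yh i.
  have /Hr [H1 H2] : ball x r (y + x).
    by rewrite -ball_normE /= opprD addrCA subrr addr0 normrN (le_lt_trans yh).
  by split; [exact: H1|exact: H2].
rewrite -![(_ + _ : _ -> _) _]/(_ + _) -![(- _ : _ -> _) _]/(- _) /= opprD addrA.
rewrite (le_trans H) // ler_wpM2r // /eps mulrAC ler_pdivrMr // ler_wpM2l ?(ltW e0) //.
by rewrite lerDl.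
Qed.

Lemma diff_row_form u x : differentiable u x -> forall h, 'd u x h = \sum_i h 0 i * partial i u x.
Proof.
move=> du h; rewrite {1}[h]row_sum_delta linear_sum; apply: eq_bigr => i _.
by rewrite linearZ /= /partial deriveE.
Qed.

End TotalDerivative.

(** * Closure properties of smooth functions and the rules for partial derivatives *)

Section SmoothFunctions.
Context {R : realType} {n : nat}.
Variable U : set 'rV[R]_n.
Hypothesis oU : open U.
Implicit Types (u v : 'rV[R]_n -> R) (x : 'rV[R]_n).

(** Smoothness graded by order. The recursion peels off the derivative taken first, so the Leibniz
    rule reduces order k + 1 of a product to sums of products of order k, and closure follows by
    induction on k. *)
Fixpoint Ck (k : nat) u : Prop :=
  (forall x, U x -> {for x, continuous u}) /\
  if k is k'.+1 then forall i, (forall x, U x -> derivable u x (delta_mx 0 i)) /\ Ck k' (partial i u)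
  else True.

Lemma smooth_partial u i : smooth_on U u -> smooth_on U (partial i u).
Proof. by move=> su s; have := su (rcons s i); rewrite /iter_partial foldr_rcons. Qed.

Lemma smooth_continuous u x : smooth_on U u -> U x -> {for x, continuous u}.
Proof. by move=> su Ux; have [] := su [::] x Ux. Qed.

Lemma smooth_derivable u x i : smooth_on U u -> U x -> derivable u x (delta_mx 0 i).
Proof. by move=> su Ux; have [_ ] := su [::] x Ux; apply. Qed.

Lemma smooth_onP u : smooth_on U u <-> forall k, Ck k u.
Proof.
split=> [su k|ku s].
  elim: k u su => [|k IH] u su; split=> // x; try exact: smooth_continuous.
  by split=> [y|]; [exact: smooth_derivable|exact/IH/smooth_partial].
(* The last entry of the sequence is the innermost derivative, the one that [Ck] peels off. *)
elim/last_ind: s u ku => [|s i IH] u ku x Ux.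
  by split=> [|i]; [have [H _] := ku 0%N; exact: H|have [_ /(_ i) [H _]] := ku 1%N; exact: H].
rewrite /iter_partial foldr_rcons; apply: IH => // k.
by have [_ /(_ i) []] := ku k.+1.
Qed.

Lemma near_eqP u v x : (forall y, U y -> u y = v y) -> U x -> \forall y \near x, u y = v y.
Proof. by move=> uv Ux; apply: filterS (open_nbhs_nbhs (conj oU Ux)) => y; exact: uv. Qed.

Lemma eq_partial u v i x : (forall y, U y -> u y = v y) -> U x -> partial i u x = partial i v x.
Proof. by move=> uv Ux; apply: near_eq_derive; exact: near_eqP. Qed.

Lemma eq_continuous u v x : (forall y, U y -> u y = v y) -> U x ->
  {for x, continuous u} -> {for x, continuous v}.
Proof.
move=> uv Ux cu; rewrite /prop_for /continuous_at -(uv x Ux).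
by apply: cvg_trans cu; have := near_eq_cvg (near_eqP uv Ux); apply.
Qed.

Lemma eq_Ck k u v : (forall y, U y -> u y = v y) -> Ck k u -> Ck k v.
Proof.
elim: k u v => [|k IH] u v uv.
  move=> [cu _]; split=> // x Ux.
  exact: eq_continuous (cu x Ux).
move=> [cu du]; split=> [x Ux|i]; first exact: eq_continuous (cu x Ux).
have [di ki] := du i; split=> [x Ux|].
  by apply: near_eq_derivable (di x Ux); exact: near_eqP.
by apply: IH ki => y; exact: eq_partial.
Qed.

Lemma CkW k u : Ck k.+1 u -> Ck k u.
Proof.
elim: k u => [|k IH] u [cu du]; split=> // i.
by have [di ki] := du i; split=> //; exact: IH.
Qed.

Lemma Ck_cst k (c : R) : Ck k (fun=> c).
Proof.
elim: k c => [|k IH] c; first by split=> // x _; exact: cst_continuous.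
split=> [x _|i]; first exact: cst_continuous.
split=> [x _|]; first exact: derivable_cst.
by apply: eq_Ck (IH 0) => y Uy; rewrite /partial derive_cst.
Qed.

Lemma CkD k u v : Ck k u -> Ck k v -> Ck k (fun x => u x + v x).
Proof.
elim: k u v => [|k IH] u v [cu du] [cv dv].
  by split=> // x Ux; apply: continuousD; [exact: cu|exact: cv].
split=> [x Ux|i]; first by apply: continuousD; [exact: cu|exact: cv].
have [diu kiu] := du i; have [div kiv] := dv i; split=> [x Ux|].
  by apply: derivableD; [exact: diu|exact: div].
apply: eq_Ck (IH _ _ kiu kiv) => y Uy.
by rewrite /partial [RHS]deriveD //; [exact: diu|exact: div].
Qed.

Lemma CkM k u v : Ck k u -> Ck k v -> Ck k (fun x => u x * v x).
Proof.
elim: k u v => [|k IH] u v [cu du] [cv dv].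
  by split=> // x Ux; apply: continuousM; [exact: cu|exact: cv].
split=> [x Ux|i]; first by apply: continuousM; [exact: cu|exact: cv].
have [diu kiu] := du i; have [div kiv] := dv i; split=> [x Ux|].
  by apply: derivableM; [exact: diu|exact: div].
have ku : Ck k u by apply: CkW; split.
have kv : Ck k v by apply: CkW; split.
apply: eq_Ck (CkD (IH _ _ ku kiv) (IH _ _ kv kiu)) => y Uy.
by rewrite /partial [RHS]deriveM //; [exact: diu|exact: div].
Qed.

(** The derivative of 1/u is - (1/u)(1/u) times that of u, so order k for 1/u itself gives order k +
    1. *)
Lemma CkV k u : (forall x, U x -> u x != 0) -> Ck k u -> Ck k (fun x => (u x)^-1).
Proof.
move=> u0; elim: k => [|k IH].
  by move=> [cu _]; split=> // x Ux; apply: continuousV; [exact: u0|exact: cu].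
move=> kSu; have kV := IH (CkW kSu); have [cu du] := kSu.
split=> [x Ux|i]; first by apply: continuousV; [exact: u0|exact: cu].
have [di ki] := du i; split=> [x Ux|].
  by apply: derivableV; [exact: u0|exact: di].
apply: eq_Ck (CkM (Ck_cst k (-1)) (CkM (CkM kV kV) ki)) => y Uy.
rewrite /partial deriveV; [|exact: u0|exact: di].
rewrite -[_ *: _]/(_ * _) -exprVn expr2 mulN1r -mulNr; congr (_ * _).
Qed.

Lemma eq_smooth u v : (forall y, U y -> u y = v y) -> smooth_on U u -> smooth_on U v.
Proof. by move=> uv /smooth_onP su; apply/smooth_onP => k; exact: eq_Ck (su k). Qed.

Lemma smooth_cst (c : R) : smooth_on U (fun=> c).
Proof. by apply/smooth_onP => k; exact: Ck_cst. Qed.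

Lemma smoothD u v : smooth_on U u -> smooth_on U v -> smooth_on U (fun x => u x + v x).
Proof. by move=> /smooth_onP su /smooth_onP sv; apply/smooth_onP => k; exact: CkD. Qed.

Lemma smoothM u v : smooth_on U u -> smooth_on U v -> smooth_on U (fun x => u x * v x).
Proof. by move=> /smooth_onP su /smooth_onP sv; apply/smooth_onP => k; exact: CkM. Qed.

Lemma smoothV u : (forall x, U x -> u x != 0) -> smooth_on U u -> smooth_on U (fun x => (u x)^-1).
Proof. by move=> u0 /smooth_onP su; apply/smooth_onP => k; exact: CkV. Qed.

Lemma smoothN u : smooth_on U u -> smooth_on U (fun x => - u x).
Proof. by move=> su; apply: eq_smooth (smoothM (smooth_cst (-1)) su) => y _; rewrite mulN1r. Qed.

Lemma smoothB u v : smooth_on U u -> smooth_on U v -> smooth_on U (fun x => u x - v x).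
Proof. by move=> su sv; exact: smoothD su (smoothN sv). Qed.

Lemma smooth_sum (I : Type) (s : seq I) (P : pred I) (F : I -> 'rV[R]_n -> R) :
  (forall i, smooth_on U (F i)) -> smooth_on U (fun x => \sum_(i <- s | P i) F i x).
Proof.
move=> sF; elim: s => [|i s IH].
  by apply: eq_smooth (smooth_cst 0) => y _; rewrite big_nil.
apply: (@eq_smooth (fun x => (if P i then F i x else 0) + \sum_(j <- s | P j) F j x)).
  by move=> y _; rewrite big_cons; case: ifP => // _; rewrite add0r.
case: (P i); [exact: (smoothD (sF i) IH)|exact: (smoothD (smooth_cst 0) IH)].
Qed.

Lemma smooth_prod (I : Type) (s : seq I) (F : I -> 'rV[R]_n -> R) :
  (forall i, smooth_on U (F i)) -> smooth_on U (fun x => \prod_(i <- s) F i x).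
Proof.
move=> sF; elim: s => [|i s IH].
  by apply: eq_smooth (smooth_cst 1) => y _; rewrite big_nil.
by apply: eq_smooth (smoothM (sF i) IH) => y _; rewrite big_cons.
Qed.

Lemma partial_cst i (c : R) x : partial i (fun=> c) x = 0.
Proof. exact: derive_cst. Qed.

Lemma partialD i u v x : smooth_on U u -> smooth_on U v -> U x ->
  partial i (fun y => u y + v y) x = partial i u x + partial i v x.
Proof. by move=> su sv Ux; rewrite /partial; rewrite [LHS]deriveD //; exact: smooth_derivable. Qed.

Lemma partialM i u v x : smooth_on U u -> smooth_on U v -> U x ->
  partial i (fun y => u y * v y) x = partial i u x * v x + u x * partial i v x.
Proof.
move=> su sv Ux; rewrite addrC [_ * v x]mulrC /partial.
by rewrite [LHS]deriveM //; exact: smooth_derivable.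
Qed.

Lemma partialN i u x : smooth_on U u -> U x -> partial i (fun y => - u y) x = - partial i u x.
Proof. by move=> su Ux; rewrite /partial; rewrite [LHS]deriveN //; exact: smooth_derivable. Qed.

Lemma partialB i u v x : smooth_on U u -> smooth_on U v -> U x ->
  partial i (fun y => u y - v y) x = partial i u x - partial i v x.
Proof. by move=> su sv Ux; rewrite /partial; rewrite [LHS]deriveB //; exact: smooth_derivable. Qed.

Lemma partialZ i (c : R) u x : smooth_on U u -> U x ->
  partial i (fun y => c * u y) x = c * partial i u x.
Proof. by move=> su Ux; rewrite (partialM i (smooth_cst c) su Ux) partial_cst mul0r add0r. Qed.

Lemma partial_sum (I : Type) (s : seq I) (F : I -> 'rV[R]_n -> R) i x :
  (forall j, smooth_on U (F j)) -> U x ->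
  partial i (fun y => \sum_(j <- s) F j y) x = \sum_(j <- s) partial i (F j) x.
Proof.
move=> sF Ux; elim: s => [|j s IH].
  rewrite big_nil (@eq_partial _ (fun=> 0)) ?partial_cst // => y _; by rewrite big_nil.
rewrite big_cons -IH -partialD //; last exact: smooth_sum.
by apply: eq_partial => // y _; rewrite big_cons.
Qed.

Lemma partialC i j u x : smooth_on U u -> U x ->
  partial i (partial j u) x = partial j (partial i u) x.
Proof.
move=> su Ux; apply: derive_comm.
- apply: filterS (open_nbhs_nbhs (conj oU Ux)) => y Uy; split; first exact: smooth_derivable.
  exact: (@smooth_derivable (partial j u) y i (smooth_partial j su) Uy).
- apply: filterS (open_nbhs_nbhs (conj oU Ux)) => y Uy; split; first exact: smooth_derivable.
  exact: (@smooth_derivable (partial i u) y j (smooth_partial i su) Uy).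
- exact: (@smooth_continuous (partial i (partial j u)) x (smooth_partial i (smooth_partial j su)) Ux).
- exact: (@smooth_continuous (partial j (partial i u)) x (smooth_partial j (smooth_partial i su)) Ux).
Qed.

Lemma smooth_differentiable u x : smooth_on U u -> U x -> differentiable u x.
Proof.
move=> su Ux; apply: C1_differentiable => [|i].
  by apply: filterS (open_nbhs_nbhs (conj oU Ux)) => y Uy i; exact: smooth_derivable.
exact: (@smooth_continuous (partial i u) x (smooth_partial i su) Ux).
Qed.

End SmoothFunctions.

Lemma smooth_subset (R : realType) n (U W : set 'rV[R]_n) u : W `<=` U -> smooth_on U u -> smooth_on W u.
Proof. by move=> WU su s x Wx; exact: su (WU _ Wx). Qed.

(** * Jacobians and the chain rule for smooth maps *)

Section ChainRule.
Context {R : realType} {n : nat}.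
Variables O O' : set 'rV[R]_n.
Hypotheses (oO : open O) (oO' : open O').
Variable F : 'rV[R]_n -> 'rV[R]_n.
Hypothesis sF : smooth_mx_on O F.
Hypothesis FO : forall x, O x -> O' (F x).
Implicit Types (x : 'rV[R]_n) (i j k l : 'I_n).

Lemma smooth_map_differentiable x : O x -> differentiable F x.
Proof.
move=> Ox.
have -> : F = \sum_(j < n) (fun y => F y 0 j *: (delta_mx 0 j : 'rV[R]_n)).
  by apply/funext => y; rewrite fct_sumE -row_sum_delta.
apply: differentiable_sum => j; apply: differentiableZl.
exact: (smooth_differentiable oO (sF 0 j)).
Qed.

Lemma jacobianE x i j : O x -> 'J F x i j = partial i (fun y => F y 0 j) x.
Proof.
move=> Ox; have dF := smooth_map_differentiable Ox.
rewrite /jacobian mxE /partial -deriveE //.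
by rewrite derive_mx ?mxE //; exact: diff_derivable.
Qed.

Lemma partial_comp (u : 'rV[R]_n -> R) i x : smooth_on O' u -> O x ->
  partial i (u \o F) x = \sum_j 'J F x i j * partial j u (F x).
Proof.
move=> su Ox; have dF := smooth_map_differentiable Ox.
have du : differentiable u (F x) := smooth_differentiable oO' su (FO Ox).
rewrite {1}/partial deriveE; last exact: differentiable_comp.
rewrite diff_comp //= diff_row_form //; apply: eq_bigr => j _.
by rewrite /jacobian mxE.
Qed.

End ChainRule.

#[local] Opaque partial.

(** * Derivatives of matrix-valued functions, inverses and determinants *)

Section MatrixCalculus.
Context {R : realType} {n : nat}.
Variable U : set 'rV[R]_n.
Hypothesis oU : open U.
Implicit Types (u : 'rV[R]_n -> R) (x : 'rV[R]_n) (k : 'I_n).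

Definition dmx m p k (B : 'rV[R]_n -> 'M[R]_(m, p)) : 'rV[R]_n -> 'M[R]_(m, p) :=
  fun x => \matrix_(i, j) partial k (fun y => B y i j) x.

Lemma eq_smooth_mx m p (B C : 'rV[R]_n -> 'M[R]_(m, p)) :
  (forall y, U y -> B y = C y) -> smooth_mx_on U B -> smooth_mx_on U C.
Proof. by move=> BC sB i j; apply: (eq_smooth oU) (sB i j) => y Uy; rewrite BC. Qed.

Lemma smooth_dmx m p k (B : 'rV[R]_n -> 'M[R]_(m, p)) :
  smooth_mx_on U B -> smooth_mx_on U (dmx k B).
Proof.
by move=> sB i j; apply: (eq_smooth oU) (smooth_partial k (sB i j)) => y Uy; rewrite mxE.
Qed.

Lemma smooth_mx_cst m p (B : 'M[R]_(m, p)) : smooth_mx_on U (fun=> B).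
Proof. by move=> i j; exact: smooth_cst. Qed.

Lemma smooth_mxD m p (B C : 'rV[R]_n -> 'M[R]_(m, p)) :
  smooth_mx_on U B -> smooth_mx_on U C -> smooth_mx_on U (fun x => B x + C x).
Proof.
by move=> sB sC i j; apply: (eq_smooth oU) (smoothD oU (sB i j) (sC i j)) => y Uy; rewrite mxE.
Qed.

Lemma smooth_mxN m p (B : 'rV[R]_n -> 'M[R]_(m, p)) :
  smooth_mx_on U B -> smooth_mx_on U (fun x => - B x).
Proof.
by move=> sB i j; apply: (eq_smooth oU) (smoothN oU (sB i j)) => y Uy; rewrite mxE.
Qed.

Lemma smooth_mxB m p (B C : 'rV[R]_n -> 'M[R]_(m, p)) :
  smooth_mx_on U B -> smooth_mx_on U C -> smooth_mx_on U (fun x => B x - C x).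
Proof. by move=> sB sC; exact: smooth_mxD sB (smooth_mxN sC). Qed.

Lemma smooth_mxZ m p u (B : 'rV[R]_n -> 'M[R]_(m, p)) :
  smooth_on U u -> smooth_mx_on U B -> smooth_mx_on U (fun x => u x *: B x).
Proof.
by move=> su sB i j; apply: (eq_smooth oU) (smoothM oU su (sB i j)) => y Uy; rewrite mxE.
Qed.

Lemma smooth_mxM m p q (B : 'rV[R]_n -> 'M[R]_(m, p)) (C : 'rV[R]_n -> 'M[R]_(p, q)) :
  smooth_mx_on U B -> smooth_mx_on U C -> smooth_mx_on U (fun x => B x *m C x).
Proof.
move=> sB sC i j.
apply: (@eq_smooth _ _ _ oU (fun x => \sum_l B x i l * C x l j)) => [y Uy|]; first by rewrite mxE.
by apply: (smooth_sum oU) => l; exact: (smoothM oU (sB i l) (sC l j)).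
Qed.

Lemma smooth_mx_tr m p (B : 'rV[R]_n -> 'M[R]_(m, p)) :
  smooth_mx_on U B -> smooth_mx_on U (fun x => (B x)^T).
Proof. by move=> sB i j; apply: (eq_smooth oU) (sB j i) => y Uy; rewrite mxE. Qed.

Lemma smooth_mxtrace m (B : 'rV[R]_n -> 'M[R]_m) :
  smooth_mx_on U B -> smooth_on U (fun x => \tr (B x)).
Proof. by move=> sB; apply: (smooth_sum oU) => i; exact: sB. Qed.

Lemma smooth_det m (B : 'rV[R]_n -> 'M[R]_m) :
  smooth_mx_on U B -> smooth_on U (fun x => \det (B x)).
Proof.
move=> sB; apply: (smooth_sum oU) => s; apply: (smoothM oU); first exact: smooth_cst.
by apply: (smooth_prod oU) => i; exact: sB.
Qed.

Lemma smooth_adj m (B : 'rV[R]_n -> 'M[R]_m) :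
  smooth_mx_on U B -> smooth_mx_on U (fun x => \adj (B x)).
Proof.
move=> sB i j.
apply: (@eq_smooth _ _ _ oU (fun x => (-1) ^+ (j + i) * \det (row' j (col' i (B x))))).
  by move=> y Uy; rewrite mxE.
apply: (smoothM oU); first exact: smooth_cst.
apply: smooth_det => a b.
by apply: (eq_smooth oU) (sB (lift j a) (lift i b)) => y Uy; rewrite !mxE.
Qed.

Lemma smooth_invmx m (B : 'rV[R]_n -> 'M[R]_m) :
  (forall x, U x -> B x \in unitmx) ->
  smooth_mx_on U B -> smooth_mx_on U (fun x => invmx (B x)).
Proof.
move=> uB sB; apply: (@eq_smooth_mx _ _ (fun x => (\det (B x))^-1 *: \adj (B x))).
  by move=> y Uy; rewrite /invmx uB.
apply: smooth_mxZ (smooth_adj sB); apply: (smoothV oU) (smooth_det sB) => x Ux.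
by have := uB x Ux; rewrite unitmxE unitfE.
Qed.

Lemma eq_dmx m p k (B C : 'rV[R]_n -> 'M[R]_(m, p)) x :
  (forall y, U y -> B y = C y) -> U x -> dmx k B x = dmx k C x.
Proof.
by move=> BC Ux; apply/matrixP => i j; rewrite !mxE; apply: (eq_partial oU) => // y Uy; rewrite BC.
Qed.

Lemma dmx_cst m p k (B : 'M[R]_(m, p)) x : dmx k (fun=> B) x = 0.
Proof. by apply/matrixP => i j; rewrite !mxE partial_cst. Qed.

Lemma dmxD m p k (B C : 'rV[R]_n -> 'M[R]_(m, p)) x :
  smooth_mx_on U B -> smooth_mx_on U C -> U x ->
  dmx k (fun y => B y + C y) x = dmx k B x + dmx k C x.
Proof.
move=> sB sC Ux; apply/matrixP => i j; rewrite !mxE -(partialD k (sB i j) (sC i j) Ux).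
by apply: (eq_partial oU) => // y Uy; rewrite mxE.
Qed.

Lemma dmxN m p k (B : 'rV[R]_n -> 'M[R]_(m, p)) x :
  smooth_mx_on U B -> U x -> dmx k (fun y => - B y) x = - dmx k B x.
Proof.
move=> sB Ux; apply/matrixP => i j; rewrite !mxE -(partialN k (sB i j) Ux).
by apply: (eq_partial oU) => // y Uy; rewrite mxE.
Qed.

Lemma dmxB m p k (B C : 'rV[R]_n -> 'M[R]_(m, p)) x :
  smooth_mx_on U B -> smooth_mx_on U C -> U x ->
  dmx k (fun y => B y - C y) x = dmx k B x - dmx k C x.
Proof. by move=> sB sC Ux; rewrite (dmxD k sB (smooth_mxN sC) Ux) (dmxN k sC Ux). Qed.

Lemma dmxZ m p k u (B : 'rV[R]_n -> 'M[R]_(m, p)) x :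
  smooth_on U u -> smooth_mx_on U B -> U x ->
  dmx k (fun y => u y *: B y) x = partial k u x *: B x + u x *: dmx k B x.
Proof.
move=> su sB Ux; apply/matrixP => i j; rewrite !mxE -(partialM k su (sB i j) Ux).
by apply: (eq_partial oU) => // y Uy; rewrite mxE.
Qed.

Lemma dmxM m p q k (B : 'rV[R]_n -> 'M[R]_(m, p)) (C : 'rV[R]_n -> 'M[R]_(p, q)) x :
  smooth_mx_on U B -> smooth_mx_on U C -> U x ->
  dmx k (fun y => B y *m C y) x = dmx k B x *m C x + B x *m dmx k C x.
Proof.
move=> sB sC Ux; apply/matrixP => i j; rewrite !mxE.
rewrite (@eq_partial _ _ _ oU _ (fun y => \sum_l B y i l * C y l j)) //; last first.
  by move=> y Uy; rewrite mxE.
rewrite (partial_sum oU) //; last by move=> l; exact: (smoothM oU (sB i l) (sC l j)).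
rewrite -big_split /=; apply: eq_bigr => l _.
by rewrite (partialM k (sB i l) (sC l j) Ux) !mxE.
Qed.

Lemma dmx_tr m p k (B : 'rV[R]_n -> 'M[R]_(m, p)) x :
  U x -> dmx k (fun y => (B y)^T) x = (dmx k B x)^T.
Proof.
by move=> Ux; apply/matrixP => i j; rewrite !mxE; apply: (eq_partial oU) => // y Uy; rewrite mxE.
Qed.

Lemma partial_mxtrace m k (B : 'rV[R]_n -> 'M[R]_m) x :
  smooth_mx_on U B -> U x -> partial k (fun y => \tr (B y)) x = \tr (dmx k B x).
Proof.
move=> sB Ux; rewrite (partial_sum oU) //; apply: eq_bigr => i _; by rewrite mxE.
Qed.

Lemma dmxC m p k l (B : 'rV[R]_n -> 'M[R]_(m, p)) x :
  smooth_mx_on U B -> U x -> dmx k (dmx l B) x = dmx l (dmx k B) x.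
Proof.
move=> sB Ux; have E a b i j : partial a (fun y => dmx b B y i j) x = partial a (partial b (fun y => B y i j)) x.
  by apply: (eq_partial oU _ _ Ux) => y _; rewrite mxE.
apply/matrixP => i j; rewrite [LHS]mxE [RHS]mxE !E.
exact: (partialC oU k l (sB i j) Ux).
Qed.

(** Differentiate B^-1 B = 1 and multiply by B^-1 on the right. *)
Lemma dmx_invmx m k (B : 'rV[R]_n -> 'M[R]_m) x :
  (forall x, U x -> B x \in unitmx) -> smooth_mx_on U B -> U x ->
  dmx k (fun y => invmx (B y)) x = - (invmx (B x) *m dmx k B x *m invmx (B x)).
Proof.
move=> uB sB Ux; have sI := smooth_invmx uB sB.
have E : dmx k (fun y => invmx (B y) *m B y) x = 0.
  rewrite -(dmx_cst k (1%:M : 'M[R]_m) x); apply: eq_dmx => // y Uy; by rewrite mulVmx ?uB.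
rewrite (dmxM k sI sB Ux) in E.
have /(congr1 (fun M => M *m invmx (B x))) := E.
rewrite mul0mx mulmxDl mulmxK ?uB // => /eqP.
by rewrite addr_eq0 => /eqP.
Qed.

(** The differentiated factor keeps its place in the product, so each summand in the expansion of a
    determinant is again that of a matrix, with one row differentiated. *)
Lemma partial_prod (I : finType) (F : I -> 'rV[R]_n -> R) k x :
  (forall i, smooth_on U (F i)) -> U x ->
  partial k (fun y => \prod_i F i y) x =
  \sum_i \prod_j (if j == i then partial k (F j) x else F j x).
Proof.
move=> sF Ux.
suff H s : uniq s -> partial k (fun y => \prod_(i <- s) F i y) x =
    \sum_(i <- s) \prod_(j <- s) (if j == i then partial k (F j) x else F j x).
  by apply: H; exact: index_enum_uniq.
elim: s => [_|a s IH /= /andP[as_ us]].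
  rewrite big_nil (@eq_partial _ _ _ oU _ (fun=> 1)) ?partial_cst // => y _; by rewrite big_nil.
rewrite (@eq_partial _ _ _ oU _ (fun y => F a y * \prod_(i <- s) F i y)) //; last first.
  by move=> y _; rewrite big_cons.
rewrite (partialM k (sF a) (smooth_prod oU s sF) Ux) IH // !big_cons eqxx; congr (_ * _ + _).
  apply: eq_big_seq => j js; case: eqP => // ja; by move: as_; rewrite -ja js.
rewrite big_distrr /=; apply: eq_big_seq => i is_; rewrite big_cons.
by case: eqP => // ai; rewrite ai is_ in as_.
Qed.

(** Jacobi's formula: the derivative is the sum of the determinants with one row differentiated, and
    expanding along that row meets the cofactors of B, which do not see the row. *)
Lemma partial_det m k (B : 'rV[R]_n -> 'M[R]_m) x :
  smooth_mx_on U B -> U x ->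
  partial k (fun y => \det (B y)) x = \tr (\adj (B x) *m dmx k B x).
Proof.
move=> sB Ux; pose Bi i := \matrix_(a, b) (if a == i then dmx k B x a b else B x a b).
transitivity (\sum_i \det (Bi i)).
  rewrite (partial_sum oU) //; last first.
    move=> s; apply: (smoothM oU); first exact: smooth_cst.
    by apply: (smooth_prod oU) => i; exact: sB.
  rewrite exchange_big /=; apply: eq_bigr => s _.
  rewrite (partialZ oU) //; last by apply: (smooth_prod oU) => i; exact: sB.
  rewrite partial_prod // -big_distrr /=; congr (_ * _).
  apply: eq_bigr => i _; apply: eq_bigr => j _; rewrite !mxE; by case: eqP.
rewrite mxtrace_mulC; apply: eq_bigr => i _; rewrite (expand_det_row _ i) mxE.
apply: eq_bigr => j _; rewrite !mxE eqxx; congr (_ * (_ * \det _)).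
by apply/matrixP => a b; rewrite !mxE eq_sym (negbTE (neq_lift i a)).
Qed.

End MatrixCalculus.

(** * Rewriting rules for linear matrix expressions *)

Section EntrywiseLinear.
Context {R : pzRingType} {m p : nat}.
Implicit Types B C : 'M[R]_(m, p).

Let entryD B C i j : (B + C) i j = B i j + C i j. Proof. by rewrite mxE. Qed.
Let entryN B i j : (- B) i j = - B i j. Proof. by rewrite mxE. Qed.
Let entryZ a B i j : (a *: B) i j = a * B i j. Proof. by rewrite mxE. Qed.
Let entry0 i j : (0 : 'M[R]_(m, p)) i j = 0. Proof. by rewrite mxE. Qed.
Definition entryE := (entryD, entryN, entryZ, entry0).

Let trD B C : (B + C)^T = B^T + C^T. Proof. exact: linearD. Qed.
Let trN B : (- B)^T = - B^T. Proof. exact: linearN. Qed.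
Let trZ a B : (a *: B)^T = a *: B^T. Proof. exact: linearZ. Qed.
Definition trmxE := (trD, trN, trZ).
End EntrywiseLinear.

(* Products of matrices are treated as atoms. *)
Ltac mxlin := apply/matrixP => ? ?; rewrite !entryE;
  repeat match goal with |- context [@fun_of_matrix ?T ?m ?p ?M ?i ?j] =>
    let a := fresh in set a := (@fun_of_matrix T m p M i j); clearbody a end; ring.

(** * Connections on trivialized bundles, the Leibniz rule and the Ricci identity *)

Section Connections.
Context {R : realType} {n : nat}.
Variable U : set 'rV[R]_n.
Hypothesis oU : open U.
Implicit Types (x : 'rV[R]_n) (k l : 'I_n).

(* Connection matrices of a trivialized vector bundle of rank m. *)
Definition connection m := 'I_n -> 'rV[R]_n -> 'M[R]_m.

(** With X on the tangent bundle this is the connection on the cotangent bundle. The pair of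
    connections given to [nab] thus records index positions: (X, X) for A, (dual, X) for g and
    Hessians, (X, dual) for the inverse metric and B. *)
Definition dual_conn m (X : connection m) : connection m := fun k x => - (X k x)^T.

(** The trivial line bundle: columns are homomorphisms from it and rows are homomorphisms to it, so
    vectors and covectors need no separate derivative. *)
Definition flat_conn : connection 1 := fun _ _ => 0.

(* Covariant derivative of a section B of Hom(E, F), for connections Y on E and X on F. *)
Definition nab m p (X : connection m) (Y : connection p) k (B : 'rV[R]_n -> 'M[R]_(m, p)) :
    'rV[R]_n -> 'M[R]_(m, p) :=
  fun x => dmx k B x + X k x *m B x - B x *m Y k x.

Definition curv m (X : connection m) k l x : 'M[R]_m :=
  dmx k (X l) x - dmx l (X k) x + X k x *m X l x - X l x *m X k x.

Definition smooth_conn m (X : connection m) := forall k, smooth_mx_on U (X k).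

Lemma smooth_dual_conn m (X : connection m) : smooth_conn X -> smooth_conn (dual_conn X).
Proof. by move=> sX k; apply: (smooth_mxN oU); exact: (smooth_mx_tr oU). Qed.

Lemma smooth_flat_conn : smooth_conn flat_conn.
Proof. by move=> k; exact: (smooth_mx_cst oU). Qed.

Lemma dual_connK m (X : connection m) : dual_conn (dual_conn X) = X.
Proof. by apply/funext => k; apply/funext => x; rewrite /dual_conn linearN /= trmxK opprK. Qed.

Lemma smooth_nab m p (X : connection m) (Y : connection p) k B :
  smooth_conn X -> smooth_conn Y -> smooth_mx_on U B -> smooth_mx_on U (nab X Y k B).
Proof.
move=> sX sY sB; apply: (smooth_mxB oU); last exact: (smooth_mxM oU sB (sY k)).
exact: (smooth_mxD oU (smooth_dmx oU k sB) (smooth_mxM oU (sX k) sB)).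
Qed.

Lemma eq_nab m p (X : connection m) (Y : connection p) k B C x :
  (forall y, U y -> B y = C y) -> U x -> nab X Y k B x = nab X Y k C x.
Proof. by move=> BC Ux; rewrite /nab (eq_dmx oU k BC Ux) BC. Qed.

Lemma nabD m p (X : connection m) (Y : connection p) k B C x :
  smooth_mx_on U B -> smooth_mx_on U C -> U x ->
  nab X Y k (fun y => B y + C y) x = nab X Y k B x + nab X Y k C x.
Proof.
move=> sB sC Ux; rewrite /nab (dmxD oU k sB sC Ux) mulmxDr mulmxDl; mxlin.
Qed.

Lemma nabN m p (X : connection m) (Y : connection p) k B x :
  smooth_mx_on U B -> U x -> nab X Y k (fun y => - B y) x = - nab X Y k B x.
Proof. by move=> sB Ux; rewrite /nab (dmxN oU k sB Ux) mulmxN mulNmx !opprD. Qed.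

Lemma nabB m p (X : connection m) (Y : connection p) k B C x :
  smooth_mx_on U B -> smooth_mx_on U C -> U x ->
  nab X Y k (fun y => B y - C y) x = nab X Y k B x - nab X Y k C x.
Proof. by move=> sB sC Ux; rewrite (nabD _ _ _ sB (smooth_mxN oU sC) Ux) (nabN _ _ _ sC Ux). Qed.

Lemma nabZ m p (X : connection m) (Y : connection p) k u B x :
  smooth_on U u -> smooth_mx_on U B -> U x ->
  nab X Y k (fun y => u y *: B y) x = partial k u x *: B x + u x *: nab X Y k B x.
Proof.
move=> su sB Ux; rewrite /nab (dmxZ oU k su sB Ux) -scalemxAr -scalemxAl.
by rewrite scalerBr scalerDr !addrA.
Qed.

(** The terms of the middle connection Y cancel, so Y is free and is chosen to make both factors
    tensorial. *)
Lemma nabM m p q (X : connection m) (Y : connection p) (Z : connection q) k B C x :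
  smooth_mx_on U B -> smooth_mx_on U C -> U x ->
  nab X Z k (fun y => B y *m C y) x = nab X Y k B x *m C x + B x *m nab Y Z k C x.
Proof.
move=> sB sC Ux; rewrite /nab (dmxM oU k sB sC Ux) !mulmxBl !mulmxBr !mulmxDl !mulmxDr !mulmxA.
mxlin.
Qed.

Lemma nab_tr m p (X : connection m) (Y : connection p) k B x : U x ->
  nab (dual_conn Y) (dual_conn X) k (fun y => (B y)^T) x = (nab X Y k B x)^T.
Proof.
move=> Ux; rewrite /nab /dual_conn (dmx_tr oU k _ Ux) mulNmx mulmxN opprK.
by rewrite !trmxE !trmx_mul addrAC.
Qed.

Lemma nab_scalar m (X : connection m) k (a : R) x : nab X X k (fun=> a%:M) x = 0.
Proof. by rewrite /nab dmx_cst add0r scalar_mxC subrr. Qed.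

Lemma partial_trace_nab m (X : connection m) k B x :
  smooth_mx_on U B -> U x -> partial k (fun y => \tr (B y)) x = \tr (nab X X k B x).
Proof.
move=> sB Ux; rewrite (partial_mxtrace oU k sB Ux) /nab.
by rewrite raddfB raddfD /= [\tr (_ *m X k x)]mxtrace_mulC addrK.
Qed.

Lemma nab_invmx m (X : connection m) (Y : connection m) k B x :
  (forall x, U x -> B x \in unitmx) -> smooth_mx_on U B -> U x ->
  nab Y X k (fun y => invmx (B y)) x = - (invmx (B x) *m nab X Y k B x *m invmx (B x)).
Proof.
move=> uB sB Ux; rewrite /nab (dmx_invmx oU k uB sB Ux) !(mulmxBr, mulmxBl) !(mulmxDr, mulmxDl).
rewrite !mulmxA mulmxK ?uB // mulVmx ?uB // mul1mx !opprD opprK.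
by rewrite -!addrA; congr (_ + _); rewrite addrC.
Qed.

(** Here k and l are coordinate directions, not tensor slots: no Christoffel symbol acts on them and
    no torsion term arises. *)
Lemma ricci_identity m p (X : connection m) (Y : connection p) k l B x :
  smooth_conn X -> smooth_conn Y -> smooth_mx_on U B -> U x ->
  nab X Y k (nab X Y l B) x - nab X Y l (nab X Y k B) x = curv X k l x *m B x - B x *m curv Y k l x.
Proof.
move=> sX sY sB Ux.
have E a b : dmx a (nab X Y b B) x = dmx a (dmx b B) x + (dmx a (X b) x *m B x + X b x *m dmx a B x)
    - (dmx a B x *m Y b x + B x *m dmx a (Y b) x).
  rewrite (dmxB oU a (smooth_mxD oU (smooth_dmx oU b sB) (smooth_mxM oU (sX b) sB))
    (smooth_mxM oU sB (sY b)) Ux).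
  rewrite (dmxD oU a (smooth_dmx oU b sB) (smooth_mxM oU (sX b) sB) Ux).
  by rewrite (dmxM oU a (sX b) sB Ux) (dmxM oU a sB (sY b) Ux).
rewrite /nab -!/(nab _ _ _ _) !E (dmxC oU l k sB Ux) /curv /nab.
move: (dmx k (dmx l B) x) (dmx k (X l) x) (dmx l (X k) x) (dmx k (Y l) x) (dmx l (Y k) x).
move: (dmx k B x) (dmx l B x) (X k x) (X l x) (Y k x) (Y l x) (B x) => B1 B2 X1 X2 Y1 Y2 B0 D1 D2 D3 D4 D5.
rewrite !(mulmxBr, mulmxBl, mulmxDr, mulmxDl) !mulmxA.
mxlin.
Qed.

Lemma curv_mul m p (X : connection m) k l x (w : 'M[R]_(m, p)) :
  curv X k l x *m w = dmx k (X l) x *m w - dmx l (X k) x *m w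
    + X k x *m (X l x *m w) - X l x *m (X k x *m w).
Proof. by rewrite /curv mulmxBl mulmxDl mulmxBl !mulmxA. Qed.

Lemma curv_alt m (X : connection m) k l x : curv X k l x = - curv X l k x.
Proof.
rewrite /curv; move: (dmx k (X l) x) (dmx l (X k) x) (X k x) (X l x) => a b c d; mxlin.
Qed.

Lemma curv_flat k l x : curv flat_conn k l x = 0.
Proof. by rewrite /curv /flat_conn !dmx_cst mulmx0 subrr addr0 subrr. Qed.

Lemma curv_dual m (X : connection m) k l x : smooth_conn X -> U x ->
  curv (dual_conn X) k l x = - (curv X k l x)^T.
Proof.
move=> sX Ux; rewrite /curv /dual_conn.
rewrite !(dmxN oU _ (smooth_mx_tr oU (sX _)) Ux) !(dmx_tr oU _ _ Ux).
rewrite !trmxE !trmx_mul !mulNmx !mulmxN !opprK.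
mxlin.
Qed.

End Connections.

(** * Pairing of columns, basis vectors and traces *)

Section DotProduct.
Context {R : fieldType} {n : nat}.
Implicit Types (u v w : 'cV[R]_n) (M N : 'M[R]_n) (k : 'I_n).

(** The pairing is free of the metric, typically of a covector with a vector; g and its inverse
    always enter as explicit factors. *)
Definition dot u v : R := (u^T *m v) 0 0.

Definition ev k : 'cV[R]_n := delta_mx k 0.

Lemma dotE u v : u^T *m v = (dot u v)%:M.
Proof. by rewrite [LHS]mx11_scalar. Qed.

Lemma dotC u v : dot u v = dot v u.
Proof. by rewrite /dot -[in RHS](trmxK (v^T *m u)) trmx_mul trmxK [RHS]mxE. Qed.

Lemma dot_mul M u v : dot (M *m u) v = dot u (M^T *m v).
Proof. by rewrite /dot trmx_mul mulmxA. Qed.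

Lemma dotDr u v w : dot u (v + w) = dot u v + dot u w.
Proof. by rewrite /dot mulmxDr mxE. Qed.

Lemma dotDl u v w : dot (u + v) w = dot u w + dot v w.
Proof. by rewrite dotC dotDr !(dotC w). Qed.

Lemma dotBr u v w : dot u (v - w) = dot u v - dot u w.
Proof. by rewrite /dot mulmxBr !mxE. Qed.

Lemma dotNr u v : dot u (- v) = - dot u v.
Proof. by rewrite /dot mulmxN mxE. Qed.

Lemma dotZr a u v : dot u (a *: v) = a * dot u v.
Proof. by rewrite /dot -scalemxAr mxE. Qed.

Lemma dot_ev k v : dot (ev k) v = v k 0.
Proof.
rewrite /dot mxE (bigD1 k) //= big1 ?addr0 => [|j jk]; first by rewrite !mxE !eqxx mul1r.
by rewrite !mxE (negbTE jk) mul0r.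
Qed.

Lemma outer_mul u v w : u *m v^T *m w = dot v w *: u.
Proof. by rewrite -mulmxA dotE -mul_scalar_mx scalar_mxC. Qed.

Lemma trace_outer u v : \tr (u *m v^T) = dot v u.
Proof. by rewrite mxtrace_mulC dotE mxtrace_scalar mulr1n. Qed.

Lemma dot_sumr (I : finType) u (F : I -> 'cV[R]_n) : dot u (\sum_i F i) = \sum_i dot u (F i).
Proof. by rewrite /dot mulmx_sumr summxE. Qed.

Lemma mul_evE M j i : (M *m ev j) i 0 = M i j.
Proof. by rewrite -colE mxE. Qed.

Lemma trace_outer_mul u v M : \tr (u *m v^T *m M) = dot v (M *m u).
Proof. by rewrite -mulmxA mxtrace_mulC -mulmxA dotE mxtrace_scalar mulr1n. Qed.

Lemma dot_trmul u M v : dot u (M^T *m v) = dot (M *m u) v.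
Proof. by rewrite dot_mul. Qed.

Lemma sum_ev v : \sum_k v k 0 *: ev k = v.
Proof.
apply/colP => i; rewrite summxE (bigD1 i) //= big1 ?addr0 => [|j ji].
  by rewrite !mxE !eqxx mulr1.
by rewrite !mxE eq_sym (negbTE ji) mulr0.
Qed.

Lemma sum_mul_ev M v : \sum_k v k 0 *: (M *m ev k) = M *m v.
Proof.
by rewrite -[in RHS](sum_ev v) mulmx_sumr; apply: eq_bigr => k _; rewrite scalemxAr.
Qed.

Lemma sum_dot_ev M v : \sum_k dot v (ev k) *: (M *m ev k) = M *m v.
Proof. by rewrite -sum_mul_ev; apply: eq_bigr => k _; rewrite dotC dot_ev. Qed.

Lemma trace_ev M : \sum_k dot (ev k) (M *m ev k) = \tr M.
Proof.
apply: eq_bigr => k _; rewrite dot_ev mxE (bigD1 k) //= big1 ?addr0 => [|j jk].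
  by rewrite !mxE !eqxx mulr1.
by rewrite !mxE (negbTE jk) mulr0.
Qed.

Lemma sum_dot_scale_ev M v : \sum_k dot (ev k) (M *m ev k) *: v = \tr M *: v.
Proof. by rewrite -scaler_suml trace_ev. Qed.

Lemma sum_dot_dot u v : \sum_k dot (ev k) u * dot (ev k) v = dot u v.
Proof. by rewrite [RHS]mxE; apply: eq_bigr => k _; rewrite !dot_ev mxE. Qed.

Lemma dot_eqP u v : (forall k, dot (ev k) u = dot (ev k) v) -> u = v.
Proof. by move=> uv; apply/colP => k; rewrite -!dot_ev. Qed.

Lemma mx_ev_eqP M N : (forall k, M *m ev k = N *m ev k) -> M = N.
Proof.
move=> MN; apply/matrixP => i j; have /colP/(_ i) := MN j.
by rewrite -!colE !mxE.
Qed.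

End DotProduct.

(** * Pair symmetry of the curvature tensor *)

(* Rc k l stands for the curvature operator R(e_k, e_l) of the metric g. *)
Section CurvatureSymmetries.
Context {R : realFieldType} {n : nat}.
Variables (g : 'M[R]_n) (Rc : 'I_n -> 'I_n -> 'M[R]_n).
Hypothesis gT : g^T = g.
Hypothesis Rc_alt : forall k l, Rc k l = - Rc l k.
Hypothesis Rc_skew : forall k l, (Rc k l)^T *m g = - (g *m Rc k l).
Hypothesis bianchi : forall j k l, Rc k j *m ev l + Rc j l *m ev k + Rc l k *m ev j = 0.

(** The classical argument: for the lowered tensor [r], antisymmetric in both pairs, the four cyclic
    sums with each index in turn kept last combine linearly. *)
Lemma curvature_pair_symmetry k l i j :
  dot (ev i) (g *m Rc k l *m ev j) = dot (ev k) (g *m Rc i j *m ev l).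
Proof.
pose r a b c d := dot (ev d) (g *m Rc a b *m ev c) : R.
have alt a b c d : r a b c d = - r b a c d.
  by rewrite /r Rc_alt mulmxN mulNmx dotNr.
have skew a b c d : r a b c d = - r a b d c.
  by rewrite /r [in RHS]dotC dot_mul trmx_mul gT Rc_skew mulNmx dotNr opprK.
have bia a b c d : r a b c d + r b c a d + r c a b d = 0.
  rewrite /r -!dotDr -!mulmxA -!mulmxDr (bianchi b a c) mulmx0.
  by rewrite /dot mulmx0 mxE.
rewrite -/(r k l j i) -/(r i j l k) (alt i j l k) (skew j i l k) opprK.
have := bia k l j i; have := bia l j i k; have := bia j i k l; have := bia i k l j.
have := skew k l i j; have := skew l j i k; have := skew j i l k; have := skew i k l j.
have := alt k j i l; have := skew j k i l; have := alt i l j k; have := skew l i j k.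
lra.
Qed.

End CurvatureSymmetries.

Ltac dotring := repeat match goal with |- context [@dot ?T ?m ?u ?v] =>
  let a := fresh in set a := @dot T m u v; clearbody a end; ring.

(** * The differential of div(K_t df) at a point *)

(* Data at a point: phi and lam are the differentials of f and lambda, h and H
   their Hessians, and Dh k = nabla_k h. *)
Section PointwiseIdentity.
Context {R : realFieldType} {n : nat}.
Variables (g G A h H : 'M[R]_n) (lam phi : 'cV[R]_n).
Variables (Dh : 'I_n -> 'M[R]_n) (Rc : 'I_n -> 'I_n -> 'M[R]_n).
Hypotheses (gG : g *m G = 1%:M) (gT : g^T = g) (gA : A^T *m g = g *m A).
Hypotheses (hT : h^T = h) (HT : H^T = H) (DhT : forall k, (Dh k)^T = Dh k).
Hypothesis Dh_comm : forall k j, Dh k *m ev j - Dh j *m ev k = - ((Rc k j)^T *m phi).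
Hypothesis Rc_alt : forall k l, Rc k l = - Rc l k.
Hypothesis Rc_skew : forall k l, (Rc k l)^T *m g = - (g *m Rc k l).
Hypothesis bianchi : forall j k l, Rc k j *m ev l + Rc j l *m ev k + Rc l k *m ev j = 0.
Hypothesis Rc_A : forall l k, Rc l k *m A - A *m Rc l k =
  G *m H *m ev l *m (g *m ev k)^T + ev k *m (H *m ev l)^T
  - (G *m H *m ev k *m (g *m ev l)^T + ev l *m (H *m ev k)^T).

Let Gg : G *m g = 1%:M. Proof. exact: mulmx1C gG. Qed.

Let GT : G^T = G.
Proof. by rewrite -[LHS]mulmx1 -gG mulmxA -{1}gT -trmx_mul gG trmx1 mul1mx. Qed.

(* Because the trace of [Rc l k, A] A vanishes. *)
Lemma hessian_commutes : A^T *m H = H *m A.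
Proof.
have E l k : \tr ((Rc l k *m A - A *m Rc l k) *m A) = 0.
  by rewrite mulmxBl raddfB /= [X in X - _]mxtrace_mulC -mulmxA subrr.
have F l k : \tr (G *m H *m ev l *m (g *m ev k)^T *m A) = dot (ev k) (A^T *m H *m ev l).
  by rewrite trace_outer_mul dot_mul gT !mulmxA -gA -(mulmxA A^T g G) gG mulmx1.
have F' l k : \tr (ev k *m (H *m ev l)^T *m A) = dot (ev l) (H *m A *m ev k).
  by rewrite trace_outer_mul dot_mul HT !mulmxA.
have S l k : dot (ev l) (H *m A *m ev k) = dot (ev k) (A^T *m H *m ev l).
  by rewrite dotC dot_mul trmx_mul HT.
apply: mx_ev_eqP => l; apply: dot_eqP => k.
have := E l k; rewrite Rc_A mulmxBl raddfB /= !mulmxDl !raddfD /= !F !F' !S.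
move: (dot (ev k) (A^T *m _ *m _)) (dot (ev l) _) => a b; lra.
Qed.

Section Resolvent.
Variables (t : R) (B : 'M[R]_n).
Hypotheses (BT : B^T = B) (AB : (t%:M - A) *m B = G).

(** In these abbreviations B g is (t - A)^-1, so p is its trace, and K = g B is the inverse of T = t
    - A^T on covectors; it is not the Killing tensor. *)
Let L := G *m lam.
Let l := B *m lam.
Let p := \tr (B *m g).
Let s := dot l lam.
Let T := t%:M - A^T.
Let K := g *m B.

Let Tg : T *m g = g *m (t%:M - A).
Proof. by rewrite mulmxBl mulmxBr gA scalar_mxC. Qed.

Let TK : T *m K = 1%:M. Proof. by rewrite mulmxA Tg -mulmxA AB gG. Qed.

Let KT : K *m T = 1%:M. Proof. exact: mulmx1C TK. Qed.

Let TH : T *m H = H *m (t%:M - A).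
Proof. by rewrite /T mulmxBl mulmxBr hessian_commutes scalar_mxC. Qed.

Let THB : T *m (H *m B) = H *m G.
Proof. by rewrite mulmxA TH -mulmxA AB. Qed.

Let KHG : K *m (H *m G) = H *m B.
Proof. by rewrite -THB mulmxA KT mul1mx. Qed.

(* DA k, DB k and DOm k are the covariant derivatives of A, B and Om, opD is
   div(K_t df) / det(t - A), and opD_diff k its derivative. *)
Definition DA k := L *m (g *m ev k)^T + ev k *m lam^T.

Definition DB k := l *m (B *m g *m ev k)^T + B *m g *m ev k *m l^T.

Definition Om := A^T *m h - h *m A + lam *m phi^T - phi *m lam^T.

Definition DOm k := (DA k)^T *m h + A^T *m Dh k - (Dh k *m A + h *m DA k)
   + (H *m ev k *m phi^T + lam *m (h *m ev k)^T) - (h *m ev k *m lam^T + phi *m (H *m ev k)^T).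

(** [W M] contracts the derivative index of nabla h with one slot through M, and [rho M] is the
    curvature left over when derivatives are exchanged. For M = G they are the divergence of h and,
    up to sign, the Ricci tensor applied to grad f. *)
Let W M := \sum_j Dh j *m (M *m ev j).
Let X := G *m phi.
Let rho M := \sum_m \sum_j X m 0 *: (g *m Rc m j *m (M *m ev j)).

Definition opD := \tr (B *m h) + p * dot phi l - dot phi (B *m g *m l).

Definition opD_diff k := \tr (DB k *m h) + \tr (B *m Dh k) + (\tr (DB k *m g) * dot phi l
  + p * (dot (h *m ev k) l + dot phi (DB k *m lam + B *m (H *m ev k))))
  - (dot (h *m ev k) (B *m g *m l) + dot phi (DB k *m g *m l + B *m g *m (DB k *m lam + B *m (H *m ev k)))).

Let DBE k u : DB k *m u = dot (ev k) (K *m u) *: l + dot l u *: (B *m g *m ev k).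
Proof. by rewrite /DB mulmxDl !outer_mul dot_mul trmx_mul BT gT. Qed.

Let dot_BgE k u : dot u (B *m g *m ev k) = dot (ev k) (K *m u).
Proof. by rewrite dotC dot_mul trmx_mul BT gT. Qed.

Let dot_hE k u : dot (h *m ev k) u = dot (ev k) (h *m u).
Proof. by rewrite dot_mul hT. Qed.

Let trace_DB k M : M^T = M -> \tr (DB k *m M) = 2 * dot (ev k) (K *m (M *m l)).
Proof.
move=> MT; rewrite /DB mulmxDl raddfD /= !trace_outer_mul -[in X in _ + X]MT dot_trmul.
by rewrite [dot (M *m _) _]dotC dot_mul trmx_mul BT gT mulr_natl.
Qed.

Let gX : g *m X = phi. Proof. by rewrite mulmxA gG mul1mx. Qed.

(** The Ricci identity yields R(e_k, e_j) with the free index in the first pair. Pair symmetry makes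
    the free index the lowered output slot of R(e_m, e_j), on which T can act. *)
Let rhoE M k : M^T = M -> dot (ev k) (rho M) = \sum_j dot phi (Rc k j *m (M *m ev j)).
Proof.
move=> MT.
transitivity (\sum_j \sum_m \sum_i X m 0 * (M i j * dot (ev k) (g *m Rc m i *m ev j))).
  rewrite exchange_big /= /rho dot_sumr; apply: eq_bigr => m _.
  rewrite dot_sumr exchange_big /=; apply: eq_bigr => i _.
  rewrite dotZr -big_distrr /=; congr (_ * _).
  rewrite -[M *m ev i]sum_ev mulmx_sumr dot_sumr; apply: eq_bigr => j _.
  by rewrite -scalemxAr dotZr mul_evE -[in RHS]MT mxE.
apply: eq_bigr => j _.
rewrite -gX dot_mul gT -{2}(sum_ev X) dotC dot_sumr; apply: eq_bigr => m _.
rewrite dotZr -big_distrr /=; congr (_ * _).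
rewrite dotC -[M *m ev j]sum_ev !mulmx_sumr dot_sumr; apply: eq_bigr => i _.
rewrite -!scalemxAr dotZr mul_evE; congr (_ * _).
by rewrite mulmxA (curvature_pair_symmetry gT Rc_alt Rc_skew bianchi).
Qed.

(** By symmetry of [Dh k] the trace involves nabla_k h only through its value on e_j; exchanging k
    and j gives [W M] and costs [rho M]. *)
Let trace_Dh M k : M^T = M -> \tr (M *m Dh k) = dot (ev k) (W M - rho M).
Proof.
move=> MT; rewrite dotBr rhoE // mxtrace_mulC -trace_ev /W dot_sumr -sumrB.
apply: eq_bigr => j _; rewrite -mulmxA -{1}(DhT k) dot_trmul.
rewrite -(subrK (Dh j *m ev k) (Dh k *m ev j)) Dh_comm dotDl addrC; congr (_ + _).
  by rewrite dot_mul DhT.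
by rewrite dotC dotNr dotC dot_mul trmxK.
Qed.

Let sK (v : 'cV[R]_n) (N M : 'M[R]_n) : \sum_j dot v (M *m ev j) *: (N *m ev j) = N *m (M^T *m v).
Proof.
rewrite -sum_dot_ev; apply: eq_bigr => j _; congr (_ *: _).
by rewrite [RHS]dotC dot_trmul dotC.
Qed.

(** T passes through g as t - A. Moving t - A past R(e_m, e_j) turns B into G and leaves [R, A],
    which integrability replaces by Hessian terms; curvature survives only in [rho G], which is free
    of t. *)
Let T_rho : T *m rho B = rho G + (p *: (H *m X) - \tr (H *m B) *: phi).
Proof.
have E m j : T *m (g *m Rc m j *m (B *m ev j)) =
    g *m Rc m j *m (G *m ev j) + g *m (Rc m j *m A - A *m Rc m j) *m (B *m ev j).
  have -> : Rc m j *m A - A *m Rc m j = (t%:M - A) *m Rc m j - Rc m j *m (t%:M - A).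
    by rewrite mulmxBl mulmxBr scalar_mxC; mxlin.
  rewrite -AB (mulmxBr g) (mulmxBl (g *m _)) !mulmxA Tg.
  by rewrite [RHS]addrC subrK.
have S m j : g *m (Rc m j *m A - A *m Rc m j) *m (B *m ev j) =
   dot (ev j) (K *m ev j) *: (H *m ev m) + dot (ev m) (H *m B *m ev j) *: (g *m ev j)
   - (dot (ev m) (K *m ev j) *: (H *m ev j) + dot (ev j) (H *m B *m ev j) *: (g *m ev m)).
  have O (u v w : 'cV[R]_n) : g *m (u *m v^T) *m w = dot v w *: (g *m u) by rewrite -mulmxA outer_mul scalemxAr.
  rewrite Rc_A (mulmxBr g) !(mulmxDr g) (mulmxBl _ _ (B *m ev j)) !(mulmxDl _ _ (B *m ev j)) !O.
  by rewrite !(dot_mul g) !(dot_mul H) gT HT !mulmxA gG !mul1mx.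
have trK : \tr K = p by rewrite mxtrace_mulC.
rewrite /rho mulmx_sumr.
transitivity (\sum_m (\sum_j X m 0 *: (g *m Rc m j *m (G *m ev j)) + X m 0 *:
   (p *: (H *m ev m) + K *m (H *m ev m) - (H *m (B *m (g *m ev m)) + \tr (H *m B) *: (g *m ev m))))).
  apply: eq_bigr => m _; rewrite mulmx_sumr -trK.
  rewrite -[K *m (H *m ev m)](_ : g *m ((H *m B)^T *m ev m) = _); last first.
    by rewrite trmx_mul HT BT !mulmxA.
  rewrite -[H *m (B *m _)](_ : H *m (K^T *m ev m) = _); last by rewrite trmx_mul BT gT !mulmxA.
  rewrite -!sK -!trace_ev !scaler_suml -!big_split -sumrB scaler_sumr -big_split /=.
  by apply: eq_bigr => j _; rewrite -scalemxAr (E m j) (S m j) scalerDr.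
rewrite big_split /=; congr (_ + _).
transitivity (p *: (H *m X) + K *m (H *m X) - (H *m (B *m (g *m X)) + \tr (H *m B) *: (g *m X))).
  rewrite -[in RHS](sum_ev X) !mulmx_sumr !scaler_sumr -!big_split -sumrB /=.
  apply: eq_bigr => m _; rewrite -!scalemxAr !scalerDr scalerN scalerDr !scalerA.
  by rewrite ![X m 0 * _]mulrC.
(* The two cross terms coincide because A commutes with the Hessian of lambda. *)
have -> : K *m (H *m X) = H *m (B *m phi) by rewrite (mulmxA H G phi) (mulmxA K) KHG -mulmxA.
rewrite gX; mxlin.
Qed.

Let dD := W B - rho B + 2 *: (K *m (h *m l)) + dot phi l *: (K *m (g *m l)) + p *: (h *m l)
  + p *: (dot phi l *: (g *m l) + s *: (K *m phi) + H *m (B *m phi))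
  - h *m (B *m (g *m l)) - dot l (g *m l) *: (K *m phi) - dot phi (B *m (g *m l)) *: (g *m l)
  - s *: (K *m (K *m phi)) - H *m (B *m (K *m phi)).

Let opD_diffE k : opD_diff k = dot (ev k) dD.
Proof.
rewrite /opD_diff /dD -(mulmxA (DB k) g l) !DBE !trace_DB // trace_Dh //.
rewrite !(mulmxDr, dotDr, dotNr) -!scalemxAr !dotZr !dot_hE !dot_BgE.
have Kl : K *m lam = g *m l by rewrite /K mulmxA.
have e1 u : dot phi (B *m (H *m u)) = dot u (H *m (B *m phi)).
  by rewrite -{1}BT dot_trmul -{1}HT dot_trmul dotC.
have e2 u : dot phi (B *m g *m (B *m (H *m u))) = dot u (H *m (B *m (K *m phi))).
  by rewrite -mulmxA -{1}BT dot_trmul -{1}gT dot_trmul mulmxA -/K -{1}BT dot_trmul -{1}HT dot_trmul dotC.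
have e4 u v : dot u (B *m g *m v) = dot (K *m u) v by rewrite -dot_trmul trmx_mul BT gT.
rewrite e1 e2 !e4 !(dotC (K *m _) (ev k)) Kl -!(mulmxA B g) /s !(dotDr, dotNr) !dotZr.
have -> : dot phi (B *m (g *m l)) = dot (K *m phi) l by rewrite mulmxA e4.
dotring.
Qed.

Let sum_DOm : \sum_j DOm j *m (B *m ev j) =
  K *m (h *m L) + (2 * \tr (h *m B)) *: lam - p *: (h *m L) - 2 *: (h *m l) + H *m (B *m phi)
  - \tr (H *m B) *: phi + A^T *m W B - W (A *m B).
Proof.
have E j : DOm j *m (B *m ev j) =
    dot L (h *m B *m ev j) *: (g *m ev j) + dot (ev j) (h *m B *m ev j) *: lam
    + A^T *m (Dh j *m (B *m ev j)) - (Dh j *m (A *m B *m ev j)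
      + (dot (ev j) (K *m ev j) *: (h *m L) + dot lam (B *m ev j) *: (h *m ev j)))
    + (dot phi (B *m ev j) *: (H *m ev j) + dot (ev j) (h *m B *m ev j) *: lam)
    - (dot lam (B *m ev j) *: (h *m ev j) + dot (ev j) (H *m B *m ev j) *: phi).
  have DAT : (DA j)^T = g *m ev j *m L^T + lam *m (ev j)^T.
    by rewrite /DA trmxE [(L *m _)^T]trmx_mul [(ev j *m _)^T]trmx_mul !trmxK.
  have O2 (u v w : 'cV[R]_n) : u *m v^T *m h *m w = dot v (h *m w) *: u by rewrite -mulmxA outer_mul.
  have O3 (u v w : 'cV[R]_n) : h *m (u *m v^T) *m w = dot v w *: (h *m u).
    by rewrite -mulmxA outer_mul scalemxAr.
  rewrite /DOm DAT /DA !(mulmxDl, mulmxBl, mulNmx, mulmxDr) !(O2, O3, outer_mul).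
  by rewrite dot_hE (dot_mul H) HT (dot_mul g) gT !mulmxA.
have EW : A^T *m W B = \sum_j A^T *m (Dh j *m (B *m ev j)) by rewrite mulmx_sumr.
transitivity (g *m ((h *m B)^T *m L) + \tr (h *m B) *: lam + A^T *m W B - (W (A *m B)
      + (\tr K *: (h *m L) + h *m (B^T *m lam)))
    + (H *m (B^T *m phi) + \tr (h *m B) *: lam)
    - (h *m (B^T *m lam) + \tr (H *m B) *: phi)).
  rewrite EW /W -!sK -!sum_dot_scale_ev -!(big_split, sumrB) /=.
  by apply: eq_bigr => j _; exact: E.
rewrite trmx_mul hT BT [\tr K]mxtrace_mulC -/p -/l !mulmxA -/K.
mxlin.
Qed.

Let OmE (u : 'cV[R]_n) : Om *m u = A^T *m (h *m u) - h *m (A *m u) + dot phi u *: lam - dot lam u *: phi.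
Proof. by rewrite /Om !(mulmxDl, mulmxBl, mulNmx) !outer_mul !mulmxA. Qed.

Let W_G : W G = t *: W B - W (A *m B).
Proof.
rewrite /W scaler_sumr -sumrB; apply: eq_bigr => j _.
by rewrite -AB mulmxBl mul_scalar_mx mulmxBl -scalemxAl mulmxBr -scalemxAr.
Qed.

Let KAT (u : 'cV[R]_n) : K *m (A^T *m u) = t *: (K *m u) - u.
Proof.
rewrite -{3}[u]mul1mx -KT /T mulmxBr mulmxBl !mulmxA mul_mx_scalar -scalemxAl.
by rewrite opprB addrC subrK.
Qed.

(** For the third derivatives, T (W B) = W G - (A^T (W B) - W (A B)): the bracket is the top order
    part of nabla Om contracted with B, and W G together with - rho G from [T_rho] is the
    differential of the Laplacian. The lower order terms assemble into Om acting on vectors built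
    from l. *)
Theorem resolvent_identity :
  T *m (\col_k opD_diff k) - (2 * opD) *: lam
  = \col_k \tr (G *m Dh k) - \sum_j DOm j *m (B *m ev j)
    - Om *m (p *: l - B *m (g *m l)) + g *m (B *m (Om *m l)).
Proof.
have -> : \col_k opD_diff k = dD by apply/colP => k; rewrite mxE opD_diffE dot_ev.
have -> : \col_k \tr (G *m Dh k) = W G - rho G by apply/colP => k; rewrite mxE trace_Dh // dot_ev.
have Tu (u : 'cV[R]_n) : T *m u = t *: u - A^T *m u by rewrite /T mulmxBl mul_scalar_mx.
have TKu (u : 'cV[R]_n) : T *m (K *m u) = u by rewrite mulmxA TK mul1mx.
have THBu (u : 'cV[R]_n) : T *m (H *m (B *m u)) = H *m (G *m u) by rewrite (mulmxA H B) (mulmxA T) THB -mulmxA.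
have gl : g *m l = K *m lam by rewrite /K mulmxA.
have Ll : L = t *: l - A *m l by rewrite /L -AB -mulmxA mulmxBl mul_scalar_mx.
have dl : dot lam (B *m (g *m l)) = dot l (g *m l) by rewrite -{1}BT dot_trmul.
have dp : dot phi (B *m g *m l) = dot phi (B *m (g *m l)) by rewrite mulmxA.
have ls : dot lam l = s by rewrite dotC.
have THBK : T *m (H *m (B *m (K *m phi))) = H *m (B *m phi).
  by rewrite THBu; congr (H *m _); rewrite /K !mulmxA Gg mul1mx.
have Tgl : T *m (g *m l) = lam by rewrite gl TKu.
have HX : H *m X = H *m (G *m phi) by [].
rewrite sum_DOm (mulmxA g B) -/K !OmE !(dotBr, dotZr) dl ls W_G /opD dp /dD.
rewrite !(mulmxBr T, mulmxDr T) -!scalemxAr !(mulmxDr T) -!scalemxAr T_rho (Tu (W B)) THBK THBu Tgl !TKu.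
rewrite (Tu (h *m l)) (Tu (h *m (B *m (g *m l)))) HX.
have ABgl : A *m (B *m (g *m l)) = t *: (B *m (g *m l)) - l.
  rewrite (mulmxA A) -[A *m B](subKr (t *: B)) -mul_scalar_mx -mulmxBl AB mulmxBl.
  by rewrite mul_scalar_mx -scalemxAl (mulmxA G) Gg mul1mx.
rewrite Ll !(mulmxBr, mulmxDr, mulmxN) -!scalemxAr ABgl.
rewrite !(mulmxBr, mulmxDr, mulmxN) -!scalemxAr KAT -gl [\tr (B *m h)]mxtrace_mulC.
mxlin.
Qed.

End Resolvent.

End PointwiseIdentity.

(** * Elimination of the Laplacian between two parameters *)

Section PairIdentity.
Context {R : realFieldType} {n : nat}.
Variables (g G A Om : 'M[R]_n) (lam dL : 'cV[R]_n) (DOm : 'I_n -> 'M[R]_n).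
Hypotheses (gG : g *m G = 1%:M) (gT : g^T = g) (gA : A^T *m g = g *m A) (OmT : Om^T = - Om).
Variables (v w : R) (B C : 'M[R]_n).
Hypotheses (BT : B^T = B) (AB : (v%:M - A) *m B = G).
Hypotheses (CT : C^T = C) (AC : (w%:M - A) *m C = G).
Hypothesis vw : v != w.
Variables (dv dw : 'cV[R]_n) (Dv Dw : R).

Let Gg : G *m g = 1%:M. Proof. exact: mulmx1C gG. Qed.

Let l := B *m lam.
Let m := C *m lam.
Let E := B - C.

Definition resolvent_rhs (Z : 'M[R]_n) :=
  dL - \sum_j DOm j *m (Z *m ev j)
  - Om *m (\tr (Z *m g) *: (Z *m lam) - Z *m (g *m (Z *m lam))) + g *m (Z *m (Om *m (Z *m lam))).

Hypothesis star_v : (v%:M - A^T) *m dv - (2 * Dv) *: lam = resolvent_rhs B.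
Hypothesis star_w : (w%:M - A^T) *m dw - (2 * Dw) *: lam = resolvent_rhs C.

Let left_inv t Z : (t%:M - A) *m Z = G -> g *m Z *m (t%:M - A^T) = 1%:M.
Proof.
move=> AZ; apply: mulmx1C; rewrite mulmxA mulmxBl gA -scalar_mxC -mulmxBr -mulmxA AZ.
exact: gG.
Qed.

(** The first resolvent identity with an index raised. *)
Let EE : E = (w - v) *: (B *m g *m C).
Proof.
have BgS : B *m g *m (v%:M - A) = 1%:M.
  by apply: mulmx1C; rewrite mulmxA AB.
rewrite /E -[B - C]mul1mx -BgS -!mulmxA !scalemxAr; congr (B *m (g *m _)).
rewrite mulmxBr AB -AC -mulmxBl opprB addrA subrK -raddfB.
by rewrite mul_scalar_mx.
Qed.

Let ET : E^T = E. Proof. by rewrite /E !trmxE BT CT. Qed.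

(** Commutation of the resolvents is read off from the symmetry of E, since the transpose of B g C
    is C g B. *)
Let BgC : B *m g *m C = C *m g *m B.
Proof.
have wv : w - v != 0 by rewrite subr_eq0 eq_sym.
apply: (scalerI wv); rewrite -EE.
by rewrite -[LHS]ET EE trmxE !trmx_mul BT CT gT mulmxA.
Qed.

Let BgE : B *m g *m E = E *m g *m B.
Proof. by rewrite /E mulmxBr !mulmxBl BgC. Qed.

Let CgE : C *m g *m E = E *m g *m C.
Proof. by rewrite /E mulmxBr !mulmxBl BgC. Qed.

Let trace_skew S : S^T = S -> \tr (Om *m S) = 0.
Proof.
move=> ST; have : \tr (Om *m S) = - \tr (Om *m S).
  by rewrite -{1}mxtrace_tr trmx_mul ST OmT mulmxN raddfN /= mxtrace_mulC.
move: (\tr _) => a; lra.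
Qed.

Let sum_DB Z M : Z^T = Z ->
  \sum_j DB g lam Z j *m (M *m ev j) =
  \tr (g *m Z *m M) *: (Z *m lam) + Z *m g *m (M^T *m (Z *m lam)).
Proof.
move=> ZT; rewrite -[Z *m g *m _]sum_dot_ev -trace_ev scaler_suml -big_split; apply: eq_bigr => j _ /=.
rewrite /DB mulmxDl !outer_mul; congr (_ *: _ + _ *: _).
  by rewrite dot_mul trmx_mul ZT gT !mulmxA.
by rewrite dot_mul trmxK.
Qed.

Let raise t Z d D : (t%:M - A) *m Z = G -> (t%:M - A^T) *m d - (2 * D) *: lam = resolvent_rhs Z ->
  d - (2 * D) *: (g *m (Z *m lam)) = g *m Z *m resolvent_rhs Z.
Proof.
move=> AZ <-; rewrite [RHS]mulmxBr (mulmxA (g *m Z)) (left_inv AZ) mul1mx -scalemxAr.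
by rewrite !mulmxA.
Qed.

(** Multiplying the two equations by g C and g B, the inverses of w - A^T and v - A^T, and then by B
    and C produces the same matrix E = (w - v) B g C in front of both right sides, so dL cancels. On
    the right stands the contracted Leibniz expansion of nabla (E Om E); the last term is the share
    of the logarithmic differential of chi_v chi_w, which is - 2 (g l + g m). *)
Theorem pair_identity :
  (w - v) *: (B *m (dw - (2 * Dw) *: (g *m m)) - C *m (dv - (2 * Dv) *: (g *m l)))
  = \sum_j ((DB g lam B j - DB g lam C j) *m Om *m E + E *m DOm j *m E
       + E *m Om *m (DB g lam B j - DB g lam C j)) *m ev j
    - 2 *: (E *m Om *m E *m (g *m l + g *m m)).
Proof.
rewrite (raise AC star_w) (raise AB star_v).
have -> : (w - v) *: (B *m (g *m C *m resolvent_rhs C) - C *m (g *m B *m resolvent_rhs B))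
    = E *m (resolvent_rhs C - resolvent_rhs B).
  by rewrite EE -scalemxAl mulmxBr !mulmxA; congr (_ *: (_ - _)); rewrite BgC.
have S0 : \sum_j DOm j *m (E *m ev j) = \sum_j DOm j *m (B *m ev j) - \sum_j DOm j *m (C *m ev j).
  by rewrite -sumrB; apply: eq_bigr => j _; rewrite mulmxBl mulmxBr.
have -> : \sum_j ((DB g lam B j - DB g lam C j) *m Om *m E + E *m DOm j *m E
       + E *m Om *m (DB g lam B j - DB g lam C j)) *m ev j
  = (\sum_j DB g lam B j *m (Om *m E *m ev j) - \sum_j DB g lam C j *m (Om *m E *m ev j))
    + E *m (\sum_j DOm j *m (E *m ev j))
    + E *m (Om *m (\sum_j DB g lam B j *m (1%:M *m ev j) - \sum_j DB g lam C j *m (1%:M *m ev j))).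
  rewrite mulmx_sumr -!sumrB !mulmx_sumr -!big_split; apply: eq_bigr => j _ /=.
  move: (DB g lam B j) (DB g lam C j) (DOm j) (E) => D1 D2 D3 F.
  by rewrite !mul1mx !(mulmxBr, mulmxBl, mulmxDl, mulNmx) !mulmxA.
rewrite !sum_DB // S0.
(* E g Z is symmetric because the resolvents commute, so its trace against the antisymmetric Om
   vanishes. *)
have tz Z : Z^T = Z -> Z *m g *m E = E *m g *m Z -> \tr (g *m Z *m (Om *m E)) = 0.
  move=> ZT ZgE; rewrite mxtrace_mulC -mulmxA trace_skew // mulmxA !trmx_mul ZT gT ET.
  by rewrite mulmxA ZgE.
rewrite (tz B BT BgE) (tz C CT CgE) !scale0r !add0r trmx_mul ET OmT !trmx1 !mul1mx !mulmx1.
rewrite /resolvent_rhs -/l -/m.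
have BE u : B *m g *m (E *m - Om *m u) = - (E *m (g *m (B *m (Om *m u)))).
  by rewrite mulmxN mulNmx mulmxN !mulmxA BgE.
have CE u : C *m g *m (E *m - Om *m u) = - (E *m (g *m (C *m (Om *m u)))).
  by rewrite mulmxN mulNmx mulmxN !mulmxA CgE.
rewrite BE CE.
have EgE : E *m (g *m l + g *m m) = B *m (g *m l) - C *m (g *m m).
  rewrite /E mulmxBl !mulmxDr /l /m !(mulmxA _ g) !(mulmxA (_ *m g)) BgC.
  mxlin.
rewrite -(mulmxA (E *m Om)) EgE.
rewrite ![\tr (g *m _)]mxtrace_mulC.
rewrite -(mulmxA B g) -(mulmxA C g) !(mulmxBr, mulmxDr, mulmxN) -!scalemxAr.
rewrite !mulmxA; mxlin.
Qed.

End PairIdentity.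

(** * The Levi-Civita connection is torsion-free and metric *)

Section LeviCivita.
Context {R : realType} {n : nat}.
Variable U : set 'rV[R]_n.
Hypothesis oU : open U.
Variable g : 'rV[R]_n -> 'M[R]_n.
Hypothesis sg : smooth_mx_on U g.
Hypothesis gT : forall x, U x -> (g x)^T = g x.
Hypothesis gu : forall x, U x -> g x \in unitmx.
Implicit Types (x : 'rV[R]_n) (i j k l : 'I_n).

Definition levi_civita : connection n := fun k x => \matrix_(i, l) christoffel g i k l x.

Let Gam := levi_civita.
Let Gam' := dual_conn levi_civita.
Let G x := invmx (g x).

(** Twice the Christoffel symbols of the first kind. *)
Let lowered k x : 'M[R]_n :=
  \matrix_(l, j) (partial k (fun y => g y l j) x + partial j (fun y => g y l k) x
                  - partial l (fun y => g y k j) x).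

Let GamE k x : Gam k x = 2^-1 *: (G x *m lowered k x).
Proof.
apply/matrixP => i j; rewrite !mxE /christoffel; congr (_ * _).
by apply: eq_bigr => l _; rewrite !mxE.
Qed.

Let smooth_lowered k : smooth_mx_on U (lowered k).
Proof.
move=> l j; apply: (@eq_smooth _ _ _ oU (fun x => partial k (fun y => g y l j) x
   + partial j (fun y => g y l k) x - partial l (fun y => g y k j) x)).
  by move=> y _; rewrite mxE.
by apply: (smoothB oU); [apply: (smoothD oU)|]; exact: smooth_partial (sg _ _).
Qed.

Lemma smooth_inverse_metric : smooth_mx_on U G.
Proof. exact: (smooth_invmx oU). Qed.

Lemma smooth_levi_civita : smooth_conn U Gam.
Proof.
move=> k; apply: (eq_smooth_mx oU) (smooth_mxZ oU (smooth_cst oU 2^-1)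
  (smooth_mxM oU smooth_inverse_metric (smooth_lowered k))) => y _.
by rewrite GamE.
Qed.

Let partial_gT k i j x : U x -> partial k (fun y => g y i j) x = partial k (fun y => g y j i) x.
Proof. by move=> Ux; apply: (eq_partial oU) => // y Uy; rewrite -[in LHS]gT // mxE. Qed.

Lemma levi_civita_torsion k j x : U x -> Gam k x *m ev j = Gam j x *m ev k.
Proof.
move=> Ux; rewrite (GamE k) (GamE j) -[LHS]scalemxAl -[RHS]scalemxAl -[in LHS](mulmxA (G x)) -[in RHS](mulmxA (G x)).
congr (_ *: (_ *m _)).
apply/colP => l; rewrite !mul_evE [LHS]mxE [RHS]mxE (partial_gT l k j Ux).
by rewrite (addrC (partial k _ _)).
Qed.

(** The symmetric part of [lowered k] is the derivative of g in direction k; its two other terms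
    form an antisymmetric matrix. *)
Lemma levi_civita_metric k x : U x -> nab Gam' Gam k g x = 0.
Proof.
move=> Ux; rewrite /nab /Gam' /dual_conn -/Gam.
have E : g x *m Gam k x = 2^-1 *: lowered k x.
  by rewrite GamE -scalemxAr mulmxA mulmxV ?gu // mul1mx.
have -> : - (Gam k x)^T *m g x = - (g x *m Gam k x)^T by rewrite trmx_mul gT // mulNmx.
rewrite E; apply/matrixP => i j; rewrite !mxE.
rewrite (partial_gT k j i Ux) (partial_gT j i k Ux) (partial_gT i j k Ux).
move: (partial _ _ _) (partial _ _ _) (partial _ _ _) => a b c; lra.
Qed.

End LeviCivita.

(** * Hessians and curvature of a torsion-free metric connection *)

Section MetricConnection.
Context {R : realType} {n : nat}.
Variable U : set 'rV[R]_n.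
Hypothesis oU : open U.
Variable g : 'rV[R]_n -> 'M[R]_n.
Hypothesis sg : smooth_mx_on U g.
Hypothesis gu : forall x, U x -> g x \in unitmx.
Variable Gam : @connection R n n.
Hypothesis sGam : smooth_conn U Gam.
Hypothesis torsion_free : forall k j x, U x -> Gam k x *m ev j = Gam j x *m ev k.
Hypothesis metric : forall k x, U x -> nab (dual_conn Gam) Gam k g x = 0.
Implicit Types (x : 'rV[R]_n) (i j k l : 'I_n).

Let Gam' := dual_conn Gam.
Let flat := @flat_conn R n.
Let G x := invmx (g x).

Lemma metric_inverse k x : U x -> nab Gam Gam' k G x = 0.
Proof.
move=> Ux; rewrite /G (nab_invmx oU Gam' Gam k gu sg Ux) -/Gam' metric //.
by rewrite mulmx0 mul0mx oppr0.
Qed.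

(** The differential as a column; no index is raised. *)
Definition grad (u : 'rV[R]_n -> R) x : 'cV[R]_n := \col_i partial i u x.

Lemma smooth_grad u : smooth_on U u -> smooth_mx_on U (grad u).
Proof.
move=> su i j; apply: (eq_smooth oU) (smooth_partial i su) => y _; by rewrite mxE.
Qed.

Definition hess u x : 'M[R]_n := \matrix_(i, j) nab Gam' flat j (grad u) x i 0.

Lemma hess_ev u j x : hess u x *m ev j = nab Gam' flat j (grad u) x.
Proof. by apply/colP => i; rewrite mul_evE mxE. Qed.

Let sGam' : smooth_conn U Gam'. Proof. exact: (smooth_dual_conn oU). Qed.
Let sflat : smooth_conn U flat. Proof. exact: (smooth_flat_conn oU). Qed.

Lemma smooth_hess u : smooth_on U u -> smooth_mx_on U (hess u).
Proof.
move=> su i j; apply: (eq_smooth oU) (smooth_nab oU j sGam' sflat (smooth_grad su) i 0) => y _.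
by rewrite [RHS]mxE.
Qed.

Lemma hess_sym u x : smooth_on U u -> U x -> (hess u x)^T = hess u x.
Proof.
move=> su Ux; apply/matrixP => i j; rewrite [LHS]mxE.
have E a b : hess u x a b = partial b (partial a u) x - dot (Gam b x *m ev a) (grad u x).
  rewrite [LHS]mxE /nab mulmx0 subr0 [LHS]mxE [X in X + _]mxE; congr (_ + _).
    by apply: (eq_partial oU) => // y _; rewrite mxE.
  by rewrite /Gam' /dual_conn mulNmx mxE -dot_ev dot_trmul.
by rewrite !E (partialC oU i j su Ux) (torsion_free i j Ux).
Qed.

(** The Ricci identity applied to the parallel tensor g. *)
Lemma curv_skew k l x : U x -> (curv Gam k l x)^T *m g x = - (g x *m curv Gam k l x).
Proof.
move=> Ux; have := ricci_identity oU k l sGam' sGam sg Ux.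
have Z a b : nab Gam' Gam a (nab Gam' Gam b g) x = 0.
  rewrite (@eq_nab _ _ _ oU _ _ _ _ a _ (fun=> 0) x (fun y Uy => metric b Uy) Ux).
  by rewrite /nab dmx_cst mulmx0 mul0mx subr0 addr0.
rewrite !Z subr0 (curv_dual oU k l sGam Ux) mulNmx => /esym/eqP.
by rewrite subr_eq0 => /eqP <-; rewrite opprK.
Qed.

(** Torsion-freeness, together with its derivative, makes both the derivative terms and the
    quadratic terms cancel in the cyclic sum. *)
Lemma curv_bianchi j k l x : U x ->
  curv Gam k j x *m ev l + curv Gam j l x *m ev k + curv Gam l k x *m ev j = 0.
Proof.
move=> Ux.
have D a b c : dmx a (Gam b) x *m ev c = dmx a (Gam c) x *m ev b.
  apply/colP => i; rewrite !mul_evE [LHS]mxE [RHS]mxE; apply: (eq_partial oU _ _ Ux) => y Uy.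
  by have /colP/(_ i) := torsion_free b c Uy; rewrite !mul_evE.
rewrite !curv_mul.
rewrite [dmx k (Gam l) x *m ev j]D [dmx j (Gam k) x *m ev l]D [dmx l (Gam j) x *m ev k]D.
rewrite (torsion_free l j Ux) (torsion_free j k Ux) (torsion_free k l Ux).
move: (dmx k (Gam j) x *m ev l) (dmx j (Gam l) x *m ev k) (dmx l (Gam k) x *m ev j) => a b c.
move: (Gam k x *m _) (Gam j x *m _) (Gam l x *m _) => d e f; mxlin.
Qed.

(** The Ricci identity for du. The Christoffel term on the second slot of the Hessian is symmetric
    in k and j and drops out. *)
Lemma hess_commutator u k j x : smooth_on U u -> U x ->
  nab Gam' Gam k (hess u) x *m ev j - nab Gam' Gam j (hess u) x *m ev k
  = - ((curv Gam k j x)^T *m grad u x).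
Proof.
move=> su Ux; have := ricci_identity oU k j sGam' sflat (smooth_grad su) Ux.
rewrite (curv_dual oU k j sGam Ux) mulNmx => E.
rewrite curv_flat mulmx0 subr0 in E; rewrite -E.
have N a b : nab Gam' Gam a (hess u) x *m ev b =
    nab Gam' flat a (nab Gam' flat b (grad u)) x - hess u x *m (Gam a x *m ev b).
  rewrite /nab -!/(nab _ _ _ _) !mulmx0 !subr0 !mulmxBl mulmxDl -!mulmxA.
  have -> : dmx a (hess u) x *m ev b = dmx a (nab Gam' flat b (grad u)) x.
    apply/colP => i; rewrite mul_evE [LHS]mxE [RHS]mxE.
    by apply: (eq_partial oU _ _ Ux) => y _; rewrite [LHS]mxE.
  by rewrite (hess_ev u b x) /nab !mulmx0 !subr0.
rewrite !N (torsion_free k j Ux).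
by move: (nab _ _ k _ x) (nab _ _ j _ x) (hess u x *m _) => a b c; mxlin.
Qed.

End MetricConnection.

(** * The integrability condition of the compatibility equation *)

Section CompatibleTensor.
Context {R : realType} {n : nat}.
Variable U : set 'rV[R]_n.
Hypothesis oU : open U.
Variable g : 'rV[R]_n -> 'M[R]_n.
Hypothesis sg : smooth_mx_on U g.
Hypothesis gT : forall x, U x -> (g x)^T = g x.
Hypothesis gu : forall x, U x -> g x \in unitmx.
Variable Gam : @connection R n n.
Hypothesis sGam : smooth_conn U Gam.
Hypothesis torsion_free : forall k j x, U x -> Gam k x *m ev j = Gam j x *m ev k.
Hypothesis metric : forall k x, U x -> nab (dual_conn Gam) Gam k g x = 0.
Variables (A : 'rV[R]_n -> 'M[R]_n) (mu : 'rV[R]_n -> R).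
Hypothesis sA : smooth_mx_on U A.
Hypothesis smu : smooth_on U mu.
Hypothesis gAT : forall x, U x -> (g x *m A x)^T = g x *m A x.
Hypothesis compatible : forall k x, U x ->
  nab (dual_conn Gam) Gam k (fun y => g y *m A y) x =
  grad mu x *m (g x *m ev k)^T + g x *m ev k *m (grad mu x)^T.
Implicit Types (x : 'rV[R]_n) (i j k l : 'I_n).

Let Gam' := dual_conn Gam.
Let flat := @flat_conn R n.
Let G x := invmx (g x).
Let lam := grad mu.
Let H := hess Gam mu.

Let sG : smooth_mx_on U G. Proof. exact: (smooth_invmx oU). Qed.
Let slam : smooth_mx_on U lam. Proof. exact: (smooth_grad oU). Qed.
Let Gg x : U x -> G x *m g x = 1%:M. Proof. by move=> Ux; rewrite mulVmx ?gu. Qed.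

Lemma compatible_selfadjoint x : U x -> (A x)^T *m g x = g x *m A x.
Proof. by move=> Ux; rewrite -gAT // trmx_mul gT. Qed.

Lemma nab_compatible k x : U x -> nab Gam Gam k A x = DA (g x) (G x) (lam x) k.
Proof.
move=> Ux; have E y : U y -> A y = G y *m (g y *m A y) by move=> Uy; rewrite mulmxA Gg ?mul1mx.
rewrite (eq_nab oU Gam Gam k E Ux) (nabM oU Gam Gam' Gam k sG (smooth_mxM oU sg sA) Ux).
rewrite (metric_inverse oU sg gu metric k Ux) mul0mx add0r compatible // mulmxDr.
by rewrite /DA -/lam !mulmxA Gg ?mul1mx.
Qed.

Lemma nab_hess_potential k x : U x -> nab Gam' flat k lam x = H x *m ev k.
Proof. by rewrite -(hess_ev Gam). Qed.

(** The Ricci identity for A, with nabla A replaced by its expression in lambda; differentiating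
    once more brings in the Hessian of lambda. *)
Lemma curv_compatible l k x : U x ->
  curv Gam l k x *m A x - A x *m curv Gam l k x =
  G x *m H x *m ev l *m (g x *m ev k)^T + ev k *m (H x *m ev l)^T
  - (G x *m H x *m ev k *m (g x *m ev l)^T + ev l *m (H x *m ev k)^T).
Proof.
move=> Ux; rewrite -(ricci_identity oU l k sGam sGam sA Ux).
pose Gl y := G y *m lam y; pose ge k y := (g y *m @ev R n k)^T; pose lT y := (lam y)^T.
have sev j : smooth_mx_on U (fun=> @ev R n j) by exact: smooth_mx_cst.
have sGl : smooth_mx_on U Gl by exact: (smooth_mxM oU sG slam).
have sgej j : smooth_mx_on U (fun y => g y *m @ev R n j) by exact: (smooth_mxM oU sg (sev j)).
have sge j : smooth_mx_on U (ge j) by exact: (smooth_mx_tr oU (sgej j)).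
have slT : smooth_mx_on U lT by exact: (smooth_mx_tr oU slam).
(* The coordinate fields are not parallel, but their derivatives are symmetric in a and b and
   disappear in the commutator. *)
have nev a b : nab Gam flat a (fun=> ev b) x = Gam a x *m ev b.
  by rewrite /nab dmx_cst add0r /flat /flat_conn mulmx0 subr0.
have dflat : dual_conn flat = flat.
  by apply/funext => a; apply/funext => y; rewrite /dual_conn /flat /flat_conn trmx0 oppr0.
have nGl a : nab Gam flat a Gl x = G x *m H x *m ev a.
  rewrite (nabM oU Gam Gam' flat a sG slam Ux) (metric_inverse oU sg gu metric a Ux).
  by rewrite mul0mx add0r nab_hess_potential // mulmxA.
have nge a b : nab flat Gam a (ge b) x = (g x *m (Gam a x *m ev b))^T.
  rewrite -{1}dflat -{1}(dual_connK Gam) (nab_tr oU (dual_conn Gam) flat a _ Ux).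
  by rewrite (nabM oU Gam' Gam flat a sg (sev b) Ux) metric // mul0mx add0r nev.
have nlT a : nab flat Gam a lT x = (H x *m ev a)^T.
  rewrite -{1}dflat -{1}(dual_connK Gam) (nab_tr oU (dual_conn Gam) flat a _ Ux).
  by rewrite nab_hess_potential.
have N a b : nab Gam Gam a (nab Gam Gam b A) x =
   G x *m H x *m ev a *m (g x *m ev b)^T + Gl x *m (g x *m (Gam a x *m ev b))^T
   + (Gam a x *m ev b *m (lam x)^T + ev b *m (H x *m ev a)^T).
  have E y : U y -> nab Gam Gam b A y = Gl y *m ge b y + ev b *m lT y.
    by move=> Uy; rewrite nab_compatible.
  rewrite (eq_nab oU Gam Gam a E Ux).
  rewrite (nabD oU Gam Gam a (smooth_mxM oU sGl (sge b)) (smooth_mxM oU (sev b) slT) Ux).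
  rewrite (nabM oU Gam flat Gam a sGl (sge b) Ux) (nabM oU Gam flat Gam a (sev b) slT Ux).
  by rewrite nGl nge nlT nev.
rewrite !N (torsion_free l k Ux).
move: (G x *m H x *m ev l *m _) (G x *m H x *m ev k *m _) (Gl x *m _) (_ *m (lam x)^T).
move: (ev k *m _) (ev l *m _) => a b c d e f; mxlin.
Qed.

End CompatibleTensor.

(** * Divergence of vector fields and of bivectors *)

Section Divergence.
Context {R : realType} {n : nat}.
Variable U : set 'rV[R]_n.
Hypothesis oU : open U.
Variable Gam : @connection R n n.
Hypothesis sGam : smooth_conn U Gam.
Implicit Types (x : 'rV[R]_n) (i j k l : 'I_n) (V : 'rV[R]_n -> 'cV[R]_n).

Definition divg V x : R := \sum_j nab Gam flat_conn j V x j 0.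

Lemma eq_divg V W x : (forall y, U y -> V y = W y) -> U x -> divg V x = divg W x.
Proof.
move=> VW Ux; apply: eq_bigr => j _.
by rewrite (eq_nab oU Gam flat_conn j VW Ux).
Qed.

Lemma smooth_divg V : smooth_mx_on U V -> smooth_on U (divg V).
Proof.
move=> sV; apply: (smooth_sum oU) => j.
exact: (smooth_nab oU j sGam (smooth_flat_conn oU) sV).
Qed.

Lemma divgB V W x : smooth_mx_on U V -> smooth_mx_on U W -> U x ->
  divg (fun y => V y - W y) x = divg V x - divg W x.
Proof.
move=> sV sW Ux; rewrite /divg -sumrB; apply: eq_bigr => j _.
by rewrite (nabB oU Gam flat_conn j sV sW Ux) !entryE.
Qed.

Lemma divgN V x : smooth_mx_on U V -> U x -> divg (fun y => - V y) x = - divg V x.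
Proof.
move=> sV Ux; rewrite /divg -sumrN; apply: eq_bigr => j _.
by rewrite (nabN oU Gam flat_conn j sV Ux) !entryE.
Qed.

Lemma divgE V x : divg V x =
  \sum_j (partial j (fun y => V y j 0) x + (Gam j x *m V x) j 0).
Proof.
apply: eq_bigr => j _; rewrite /nab /flat_conn mulmx0 subr0 !entryE; congr (_ + _).
by rewrite mxE.
Qed.

Hypothesis torsion_free : forall k j x, U x -> Gam k x *m ev j = Gam j x *m ev k.

(** Torsion-freeness turns the contraction Gamma^j_jl into Gamma^j_lj, so the connection enters the
    divergence only through its traces. *)
Lemma sum_conn_row V x : U x ->
  \sum_j (Gam j x *m V x) j 0 = \sum_l \tr (Gam l x) * V x l 0.
Proof.
move=> Ux.
transitivity (\sum_j \sum_l Gam l x j j * V x l 0); last first.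
  by rewrite exchange_big /=; apply: eq_bigr => l _; rewrite big_distrl.
apply: eq_bigr => j _; rewrite mxE; apply: eq_bigr => l _; congr (_ * _).
by have /colP/(_ j) := torsion_free j l Ux; rewrite !mul_evE.
Qed.

Definition div2 (F : 'rV[R]_n -> 'M[R]_n) x : 'cV[R]_n := \sum_j nab Gam (dual_conn Gam) j F x *m ev j.

Hypothesis trace_closed : forall k l x, U x ->
  partial k (fun y => \tr (Gam l y)) x = partial l (fun y => \tr (Gam k y)) x.

(** The components of div F reduce to ordinary derivatives of F and the traces of the connection.
    The double divergence is then a double sum whose summand is antisymmetric, by symmetry of second
    derivatives and closedness of the trace form. *)
Lemma divg_div2 F x : smooth_mx_on U F -> (forall y, U y -> (F y)^T = - F y) -> U x ->
  divg (div2 F) x = 0.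
Proof.
move=> sF FT Ux.
have skew i j y : U y -> F y i j = - F y j i.
  by move=> Uy; have /matrixP/(_ j i) := FT y Uy; rewrite !mxE.
have star a : smooth_on U (fun y => \tr (Gam a y)) by exact: (smooth_mxtrace oU (sGam a)).
have E i y : U y -> div2 F y i 0 =
    \sum_j (partial j (fun z => F z i j) y + F y i j * \tr (Gam j y)).
  move=> Uy; rewrite /div2 summxE.
  have -> : \sum_j (nab Gam (dual_conn Gam) j F y *m ev j) i 0 =
    \sum_j (partial j (fun z => F z i j) y + (F y *m ((Gam j y)^T *m ev j)) i 0)
     + \sum_j (Gam j y *m F y) i j.
    rewrite -big_split; apply: eq_bigr => j _ /=.
    rewrite mul_evE /nab /dual_conn mulmxN opprK !entryE.
    rewrite [(dmx _ _ _) _ _]mxE addrAC mulmxA mul_evE; done.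
  have -> : \sum_j (Gam j y *m F y) i j = 0.
    (* The lower indices of the Christoffel symbol are symmetric and are contracted with the
       antisymmetric F. *)
    set s := LHS; suff : s = - s by move: s => s; lra.
    rewrite /s -sumrN.
    transitivity (\sum_j \sum_l Gam l y i j * F y l j).
      apply: eq_bigr => j _; rewrite mxE; apply: eq_bigr => l _; congr (_ * _).
      by have /colP/(_ i) := torsion_free j l Uy; rewrite !mul_evE.
    rewrite exchange_big /=; apply: eq_bigr => l _; rewrite mxE -sumrN.
    by apply: eq_bigr => j _; rewrite (skew j l y Uy) mulrN opprK.
  rewrite addr0 big_split [RHS]big_split /=; congr (_ + _).
  transitivity (\sum_j \sum_k F y i k * Gam j y j k).
    apply: eq_bigr => j _; rewrite mxE; apply: eq_bigr => k _.
    by rewrite mul_evE mxE.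
  rewrite exchange_big /=; apply: eq_bigr => k _; rewrite -big_distrr /=; congr (_ * _).
  apply: eq_bigr => j _.
  by have /colP/(_ j) := torsion_free j k Uy; rewrite !mul_evE.
have sterm i j : smooth_on U (fun y => partial j (fun z => F z i j) y + F y i j * \tr (Gam j y)).
  by apply: (smoothD oU); [exact: smooth_partial (sF i j)|exact: (smoothM oU (sF i j) (star j))].
rewrite divgE big_split /= (sum_conn_row (div2 F) Ux).
have -> : \sum_i partial i (fun y => div2 F y i 0) x =
  \sum_i \sum_j (partial i (partial j (fun z => F z i j)) x
    + (partial i (fun z => F z i j) x * \tr (Gam j x) + F x i j * partial i (fun y => \tr (Gam j y)) x)).
  apply: eq_bigr => i _; rewrite (eq_partial oU i (E i) Ux) (partial_sum oU _ i (sterm i) Ux).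
  apply: eq_bigr => j _.
  rewrite (partialD i (smooth_partial j (sF i j)) (smoothM oU (sF i j) (star j)) Ux).
  by rewrite (partialM i (sF i j) (star j) Ux).
have -> : \sum_l \tr (Gam l x) * div2 F x l 0 =
  \sum_i \sum_j (\tr (Gam i x) * (partial j (fun z => F z i j) x + F x i j * \tr (Gam j x))).
  by apply: eq_bigr => i _; rewrite (E i x Ux) big_distrr.
rewrite -big_split /=.
(* T is antisymmetric in (i, j), so its sum equals its own negative. *)
pose T i j := partial i (partial j (fun z => F z i j)) x
    + (partial i (fun z => F z i j) x * \tr (Gam j x) + F x i j * partial i (fun y => \tr (Gam j y)) x)
    + \tr (Gam i x) * (partial j (fun z => F z i j) x + F x i j * \tr (Gam j x)).
have T0 : \sum_i \sum_j T i j = 0.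
  have [s sE] : exists s, s = \sum_i \sum_j T i j by eexists.
  rewrite -sE; suff : s = - s by move: s {sE} => s; lra.
  rewrite {1}sE exchange_big /= sE -sumrN; apply: eq_bigr => j _; rewrite -sumrN.
  apply: eq_bigr => i _.
  have pskew a b c y : U y -> partial a (fun z => F z b c) y = - partial a (fun z => F z c b) y.
    move=> Uy; rewrite -(partialN a (sF c b) Uy).
    by apply: (eq_partial oU _ _ Uy) => z Uz; exact: skew.
  have ppskew : partial i (partial j (fun z => F z i j)) x = - partial j (partial i (fun z => F z j i)) x.
    rewrite (partialC oU i j (sF i j) Ux) -(partialN j (smooth_partial i (sF j i)) Ux).
    by apply: (eq_partial oU _ _ Ux) => z Uz; exact: pskew.
  rewrite /T ppskew (pskew i i j x Ux) (pskew j i j x Ux) (skew i j x Ux) (trace_closed i j Ux).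
  move: (partial j (partial i _) x) => a; move: (partial j (fun y => \tr (Gam i y)) x) => b.
  move: (partial i _ x) (partial j _ x) (\tr (Gam i x)) (\tr (Gam j x)) (F x j i) => c d p q e; ring.
rewrite -[RHS]T0; by apply: eq_bigr => i _; rewrite -big_split.
Qed.

End Divergence.

(** * The resolvent and the characteristic polynomial as fields *)

Section ResolventFields.
Context {R : realType} {n : nat}.
Variable U : set 'rV[R]_n.
Hypothesis oU : open U.
Variable g : 'rV[R]_n -> 'M[R]_n.
Hypothesis sg : smooth_mx_on U g.
Hypothesis gT : forall x, U x -> (g x)^T = g x.
Hypothesis gu : forall x, U x -> g x \in unitmx.
Variable Gam : @connection R n n.
Hypothesis sGam : smooth_conn U Gam.
Hypothesis metric : forall k x, U x -> nab (dual_conn Gam) Gam k g x = 0.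
Variables (A : 'rV[R]_n -> 'M[R]_n) (mu : 'rV[R]_n -> R).
Hypothesis sA : smooth_mx_on U A.
Hypothesis smu : smooth_on U mu.
Hypothesis gA : forall x, U x -> (A x)^T *m g x = g x *m A x.
Hypothesis nabA : forall k x, U x -> nab Gam Gam k A x = DA (g x) (invmx (g x)) (grad mu x) k.
Implicit Types (x : 'rV[R]_n) (i j k l : 'I_n) (t : R) (u : 'rV[R]_n -> R).

Let Gam' := dual_conn Gam.
Let flat := @flat_conn R n.
Let G x := invmx (g x).
Let lam := grad mu.
Let H := hess Gam mu.

Let sG : smooth_mx_on U G. Proof. exact: (smooth_invmx oU). Qed.
Let slam : smooth_mx_on U lam. Proof. exact: (smooth_grad oU). Qed.
Let gG x : U x -> g x *m G x = 1%:M. Proof. by move=> Ux; rewrite mulmxV ?gu. Qed.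
Let Gg x : U x -> G x *m g x = 1%:M. Proof. by move=> Ux; rewrite mulVmx ?gu. Qed.

(** The exterior derivative of the trace form is the trace of the curvature, which vanishes because
    the curvature is antisymmetric with respect to g. *)
Lemma trace_conn_closed k l x : U x ->
  partial k (fun y => \tr (Gam l y)) x = partial l (fun y => \tr (Gam k y)) x.
Proof.
move=> Ux; rewrite !(partial_mxtrace oU _ (sGam _) Ux).
have : \tr (curv Gam k l x) = - \tr (curv Gam k l x).
  have E : curv Gam k l x = - (G x *m (curv Gam k l x)^T *m g x).
    by rewrite -mulmxA (curv_skew oU sg sGam metric k l Ux) mulmxN opprK mulmxA Gg // mul1mx.
  by rewrite {1}E raddfN /= mxtrace_mulC mulmxA gG // mul1mx mxtrace_tr.
rewrite /curv; move: (dmx k _ x) (dmx l _ x) (Gam k x) (Gam l x) => a b c d.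
rewrite raddfB raddfD raddfB /= (mxtrace_mulC c d).
move: (\tr a) (\tr b) (\tr _) => p q r; lra.
Qed.

Definition shifted t x : 'M[R]_n := t%:M - A x.
Definition resolvent t x : 'M[R]_n := invmx (shifted t x) *m G x.
Definition charpoly_at t x : R := \det (shifted t x).

Section OneParameter.
Variable t : R.
Hypothesis tu : forall x, U x -> shifted t x \in unitmx.

Let S := shifted t.
Let B := resolvent t.
Let chi := charpoly_at t.

Lemma smooth_shifted : smooth_mx_on U S.
Proof. exact: (smooth_mxB oU (smooth_mx_cst oU _) sA). Qed.

Lemma smooth_resolvent : smooth_mx_on U B.
Proof. exact: (smooth_mxM oU (smooth_invmx oU tu smooth_shifted) sG). Qed.

Lemma smooth_charpoly : smooth_on U chi.
Proof. exact: (smooth_det oU smooth_shifted). Qed.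

Lemma resolventK x : U x -> (t%:M - A x) *m B x = G x.
Proof. by move=> Ux; rewrite mulmxA mulmxV ?mul1mx //; exact: tu. Qed.

Lemma resolvent_sym x : U x -> (B x)^T = B x.
Proof.
move=> Ux; have E1 : (B x)^T *m (t%:M - (A x)^T) = G x.
  have GT : (G x)^T = G x by rewrite /G trmx_inv gT.
  transitivity (((t%:M - A x) *m B x)^T); last by rewrite resolventK.
  by rewrite [RHS]trmx_mul !trmxE tr_scalar_mx.
have E2 : (t%:M - (A x)^T) *m g x *m B x = 1%:M.
  by rewrite mulmxBl gA // -scalar_mxC -mulmxBr -mulmxA resolventK // gG.
by rewrite -[LHS]mulmx1 -E2 !mulmxA E1 Gg // mul1mx.
Qed.

Let invSE x : U x -> invmx (S x) = B x *m g x.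
Proof. by move=> Ux; rewrite /B /resolvent -mulmxA Gg ?mulmx1. Qed.

Lemma nab_shifted k x : U x -> nab Gam Gam k S x = - DA (g x) (G x) (lam x) k.
Proof.
move=> Ux; rewrite (nabB oU Gam Gam k (smooth_mx_cst oU _) sA Ux) nab_scalar sub0r.
by rewrite nabA.
Qed.

(** The minus sign of the derivative of an inverse meets that of nabla (t - A) = - nabla A, and the
    two rank-one terms of nabla A are carried over by (t - A)^-1. *)
Lemma nab_resolvent k x : U x -> nab Gam Gam' k B x = DB (g x) (lam x) (B x) k.
Proof.
move=> Ux; rewrite (nabM oU Gam Gam Gam' k (smooth_invmx oU tu smooth_shifted) sG Ux).
rewrite (metric_inverse oU sg gu metric k Ux) mulmx0 addr0.
rewrite (nab_invmx oU Gam Gam k tu smooth_shifted Ux) nab_shifted // mulmxN !mulNmx opprK.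
have BT := resolvent_sym Ux.
have -> : invmx (S x) *m DA (g x) (G x) (lam x) k *m invmx (S x) *m G x
    = invmx (S x) *m DA (g x) (G x) (lam x) k *m B x by rewrite -mulmxA.
have e1 : (B x *m g x *m ev k)^T = (g x *m ev k)^T *m B x by rewrite -mulmxA [LHS]trmx_mul BT.
have e2 : (B x *m lam x)^T = (lam x)^T *m B x by rewrite [LHS]trmx_mul BT.
have e3 : B x *m lam x = invmx (S x) *m (G x *m lam x) by rewrite mulmxA.
rewrite /DB e1 e2 e3 -invSE // /DA mulmxDr mulmxDl.
by rewrite !(mulmxA (invmx (S x))) -!(mulmxA _ _ (B x)).
Qed.

(** Jacobi's formula; the plain derivative may be replaced by the covariant one because the adjugate
    commutes with t - A. The factor 2 comes from the two rank-one terms of nabla A, whose traces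
    agree by symmetry of B. *)
Lemma partial_charpoly k x : U x ->
  partial k chi x = - (2 * dot (ev k) (g x *m (B x *m lam x))) * chi x.
Proof.
move=> Ux; rewrite (partial_det oU k smooth_shifted Ux) -/S.
have -> : \tr (\adj (S x) *m dmx k S x) = \tr (\adj (S x) *m nab Gam Gam k S x).
  rewrite /nab mulmxBr mulmxDr raddfB raddfD /= !mulmxA mul_adj_mx.
  by rewrite (mxtrace_mulC (_ *m _) (S x)) mulmxA mul_mx_adj addrK.
have -> : \adj (S x) = chi x *: (B x *m g x).
  by rewrite -invSE // /invmx tu // scalerA divff ?scale1r // -unitfE -unitmxE; exact: tu.
rewrite nab_shifted // mulmxN raddfN /= -scalemxAl linearZ /= /DA mulmxDr raddfD /=.
rewrite (mulmxA (B x *m g x) (G x *m lam x)) (mulmxA _ (ev k)) !trace_outer.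
have -> : B x *m g x *m (G x *m lam x) = B x *m lam x by rewrite -mulmxA (mulmxA (g x)) gG // mul1mx.
have -> : dot (lam x) (B x *m g x *m ev k) = dot (g x *m ev k) (B x *m lam x).
  by rewrite -{1}(resolvent_sym Ux) -mulmxA dot_trmul dotC.
rewrite dot_mul gT //; move: (dot _ _) (chi x) => a b; ring.
Qed.

Section OneFunction.
Variable u : 'rV[R]_n -> R.
Hypothesis su : smooth_on U u.

Let phi := grad u.
Let h := hess Gam u.
Let sB : smooth_mx_on U B. Proof. exact: smooth_resolvent. Qed.
Let sphi : smooth_mx_on U phi. Proof. exact: (smooth_grad oU). Qed.
Let sh : smooth_mx_on U h. Proof. exact: (smooth_hess oU sGam su). Qed.
Let sBl : smooth_mx_on U (fun y => B y *m lam y). Proof. exact: (smooth_mxM oU sB slam). Qed.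

Definition reduced_operator x : R := opD (g x) (h x) (lam x) (phi x) (B x).

Lemma smooth_dot (V W : 'rV[R]_n -> 'cV[R]_n) :
  smooth_mx_on U V -> smooth_mx_on U W -> smooth_on U (fun y => dot (V y) (W y)).
Proof. by move=> sV sW; exact: (smooth_mxM oU (smooth_mx_tr oU sV) sW). Qed.

Lemma nab_covector_tr (V : 'rV[R]_n -> 'cV[R]_n) k x : U x ->
  nab flat Gam k (fun y => (V y)^T) x = (nab Gam' flat k V x)^T.
Proof.
move=> Ux; have dflat : dual_conn flat = flat.
  by apply/funext => a; apply/funext => y; rewrite /dual_conn /flat /flat_conn trmx0 oppr0.
by rewrite -{1}dflat -{1}(dual_connK Gam) (nab_tr oU (dual_conn Gam) flat k _ Ux).
Qed.

Lemma partial_dot (V W : 'rV[R]_n -> 'cV[R]_n) k x :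
  smooth_mx_on U V -> smooth_mx_on U W -> U x ->
  partial k (fun y => dot (V y) (W y)) x =
  dot (nab Gam' flat k V x) (W x) + dot (V x) (nab Gam flat k W x).
Proof.
move=> sV sW Ux.
rewrite (eq_partial oU k (fun y _ => esym (trace_outer (W y) (V y))) Ux).
rewrite (partial_trace_nab oU Gam k (smooth_mxM oU sW (smooth_mx_tr oU sV)) Ux).
rewrite (nabM oU Gam flat Gam k sW (smooth_mx_tr oU sV) Ux).
by rewrite nab_covector_tr // raddfD /= !trace_outer addrC.
Qed.

Lemma smooth_reduced_operator : smooth_on U reduced_operator.
Proof.
apply: (smoothB oU); [apply: (smoothD oU)|].
- exact: (smooth_mxtrace oU (smooth_mxM oU sB sh)).
- apply: (smoothM oU); first exact: (smooth_mxtrace oU (smooth_mxM oU sB sg)).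
  exact: (smooth_dot sphi sBl).
- exact: (smooth_dot sphi (smooth_mxM oU (smooth_mxM oU sB sg) sBl)).
Qed.

Lemma partial_reduced_operator k x : U x ->
  partial k reduced_operator x =
  opD_diff (g x) (h x) (H x) (lam x) (phi x) (fun k => nab Gam' Gam k h x) (B x) k.
Proof.
move=> Ux; rewrite /reduced_operator /opD.
have sBh := smooth_mxtrace oU (smooth_mxM oU sB sh).
have sBg := smooth_mxtrace oU (smooth_mxM oU sB sg).
have sd1 := smooth_dot sphi sBl.
have sBgl := smooth_mxM oU (smooth_mxM oU sB sg) sBl.
have sd2 := smooth_dot sphi sBgl.
rewrite (partialB k (smoothD oU sBh (smoothM oU sBg sd1)) sd2 Ux).
rewrite (partialD k sBh (smoothM oU sBg sd1) Ux) (partialM k sBg sd1 Ux).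
rewrite (partial_trace_nab oU Gam k (smooth_mxM oU sB sh) Ux).
rewrite (partial_trace_nab oU Gam k (smooth_mxM oU sB sg) Ux).
rewrite (partial_dot k sphi sBl Ux) (partial_dot k sphi sBgl Ux).
rewrite (nabM oU Gam Gam' Gam k sB sh Ux) (nabM oU Gam Gam' Gam k sB sg Ux).
rewrite (nabM oU Gam Gam flat k (smooth_mxM oU sB sg) sBl Ux).
rewrite (nabM oU Gam Gam' Gam k sB sg Ux) (nabM oU Gam Gam' flat k sB slam Ux).
rewrite metric // mulmx0 addr0 nab_resolvent // -(hess_ev Gam mu) -(hess_ev Gam u).
by rewrite /opD_diff raddfD.
Qed.

(** The origin of [opD]: the term phi^T B g l occurs with coefficient -2 from d chi and +1 from
    nabla B, which leaves its minus sign. *)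
Lemma divg_resolvent_grad x : U x ->
  divg Gam (fun y => (chi y *: B y) *m phi y) x = chi x * reduced_operator x.
Proof.
move=> Ux; rewrite /divg.
have E j : nab Gam flat j (fun y => (chi y *: B y) *m phi y) x j 0 =
   dot (ev j) (partial j chi x *: (B x *m phi x)
     + chi x *: (DB (g x) (lam x) (B x) j *m phi x + B x *m (h x *m ev j))).
  rewrite dot_ev (nabM oU Gam Gam' flat j (smooth_mxZ oU smooth_charpoly sB) sphi Ux).
  rewrite (nabZ oU Gam Gam' j smooth_charpoly sB Ux) nab_resolvent // -(hess_ev Gam u).
  by rewrite mulmxDl -!scalemxAl -addrA -scalerDr.
rewrite /reduced_operator /opD.
have BT := resolvent_sym Ux.
pose l := B x *m lam x; pose b := B x *m phi x.
transitivity (\sum_j (chi x * (- 2 * (dot (ev j) (g x *m l) * dot (ev j) b)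
   + (dot (ev j) (g x *m b) * dot (ev j) l + dot l (phi x) * dot (ev j) (B x *m g x *m ev j)
   + dot (ev j) (B x *m h x *m ev j))))).
  apply: eq_bigr => j _; rewrite E partial_charpoly // /DB mulmxDl !outer_mul -/l -/b.
  have bg : dot (B x *m g x *m ev j) (phi x) = dot (ev j) (g x *m b).
    by rewrite -mulmxA dot_mul BT dot_mul gT.
  rewrite !(dotDr, dotZr) bg (mulmxA (B x) (h x)).
  by move: (chi x) => c; dotring.
rewrite -big_distrr big_split -big_distrr !big_split -big_distrr /= !sum_dot_dot !trace_ev.
have -> : dot (g x *m l) b = dot (phi x) (B x *m g x *m l).
  by rewrite dotC /b dot_mul BT mulmxA.
have -> : dot (g x *m b) l = dot (phi x) (B x *m g x *m l).
  by rewrite dot_mul gT // /b dot_mul BT mulmxA.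
rewrite (dotC l) -/l; move: (\tr _) (\tr _) (chi x) => p q c; dotring.
Qed.

End OneFunction.
End OneParameter.
End ResolventFields.

(** * Commutation on an open set where both resolvents exist *)

Section LocalCommutation.
Context {R : realType} {n : nat}.
Variable U : set 'rV[R]_n.
Hypothesis oU : open U.
Variable g : 'rV[R]_n -> 'M[R]_n.
Hypothesis sg : smooth_mx_on U g.
Hypothesis gT : forall x, U x -> (g x)^T = g x.
Hypothesis gu : forall x, U x -> g x \in unitmx.
Variable Gam : @connection R n n.
Hypothesis sGam : smooth_conn U Gam.
Hypothesis torsion_free : forall k j x, U x -> Gam k x *m ev j = Gam j x *m ev k.
Hypothesis metric : forall k x, U x -> nab (dual_conn Gam) Gam k g x = 0.
Variables (A : 'rV[R]_n -> 'M[R]_n) (mu : 'rV[R]_n -> R).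
Hypothesis sA : smooth_mx_on U A.
Hypothesis smu : smooth_on U mu.
Hypothesis gAT : forall x, U x -> (g x *m A x)^T = g x *m A x.
Hypothesis compatible : forall k x, U x ->
  nab (dual_conn Gam) Gam k (fun y => g y *m A y) x =
  grad mu x *m (g x *m ev k)^T + g x *m ev k *m (grad mu x)^T.
Implicit Types (x : 'rV[R]_n) (i j k l : 'I_n) (t : R).

Let Gam' := dual_conn Gam.
Let flat := @flat_conn R n.
Let G x := invmx (g x).
Let lam := grad mu.
Let H := hess Gam mu.

Let sG : smooth_mx_on U G. Proof. exact: (smooth_invmx oU). Qed.
Let slam : smooth_mx_on U lam. Proof. exact: (smooth_grad oU). Qed.
Let gG x : U x -> g x *m G x = 1%:M. Proof. by move=> Ux; rewrite mulmxV ?gu. Qed.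
Let gA := fun x => @compatible_selfadjoint _ _ _ _ gT _ gAT x.
Let nabA := fun k x => @nab_compatible _ _ _ oU _ sg gu _ metric _ _ sA compatible k x.

(** The operator of the theorem in coordinates without its minus sign, for an arbitrary
    connection. *)
Definition contravariant_operator t (u : 'rV[R]_n -> R) x : R :=
  divg Gam (fun y => \adj (shifted A t y) *m G y *m grad u y) x.

Let Q := contravariant_operator.

Lemma smooth_contravariant t : smooth_mx_on U (fun y => \adj (shifted A t y) *m G y).
Proof. exact: (smooth_mxM oU (smooth_adj oU (smooth_shifted oU sA t)) sG). Qed.

Lemma smooth_contravariant_operator t u : smooth_on U u -> smooth_on U (Q t u).
Proof.
move=> su; apply: (smooth_divg oU sGam).
exact: (smooth_mxM oU (smooth_contravariant t) (smooth_grad oU su)).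
Qed.

Variable u : 'rV[R]_n -> R.
Hypothesis su : smooth_on U u.

Let phi := grad u.
Let h := hess Gam u.
Let Dh x k := nab Gam' Gam k h x.
Let sphi : smooth_mx_on U phi. Proof. exact: (smooth_grad oU su). Qed.
Let sh : smooth_mx_on U h. Proof. exact: (smooth_hess oU sGam su). Qed.

Definition omega x := Om (A x) (h x) (lam x) (phi x).

Let D_omega x k := DOm (g x) (G x) (A x) (h x) (H x) (lam x) (phi x) (Dh x) k.

Lemma smooth_omega : smooth_mx_on U omega.
Proof.
apply: (smooth_mxB oU); last exact: (smooth_mxM oU sphi (smooth_mx_tr oU slam)).
apply: (smooth_mxD oU); last exact: (smooth_mxM oU slam (smooth_mx_tr oU sphi)).
exact: (smooth_mxB oU (smooth_mxM oU (smooth_mx_tr oU sA) sh) (smooth_mxM oU sh sA)).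
Qed.

Lemma omega_skew x : U x -> (omega x)^T = - omega x.
Proof.
move=> Ux; have hT : (h x)^T = h x by exact: (hess_sym oU torsion_free).
rewrite /omega /Om !trmxE !trmx_mul !trmxK hT.
move: (_ *m A x) ((A x)^T *m _) (lam x *m _) (phi x *m _) => a b c d; mxlin.
Qed.

Lemma nab_omega k x : U x -> nab Gam' Gam k omega x = D_omega x k.
Proof.
move=> Ux; have sAT := smooth_mx_tr oU sA; have sphT := smooth_mx_tr oU sphi.
have slT := smooth_mx_tr oU slam.
have sAh := smooth_mxM oU sAT sh; have shA := smooth_mxM oU sh sA.
have slp := smooth_mxM oU slam sphT; have spl := smooth_mxM oU sphi slT.
rewrite /omega /Om (nabB oU Gam' Gam k (smooth_mxD oU (smooth_mxB oU sAh shA) slp) spl Ux).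
rewrite (nabD oU Gam' Gam k (smooth_mxB oU sAh shA) slp Ux) (nabB oU Gam' Gam k sAh shA Ux).
rewrite (nabM oU Gam' Gam' Gam k sAT sh Ux) (nabM oU Gam' Gam Gam k sh sA Ux).
rewrite (nabM oU Gam' flat Gam k slam sphT Ux) (nabM oU Gam' flat Gam k sphi slT Ux).
rewrite !(nab_covector_tr oU Gam _ k Ux) (nab_tr oU Gam Gam k A Ux) nabA //.
by rewrite -(hess_ev Gam mu) -(hess_ev Gam u).
Qed.

Section OneParameter.
Variable t : R.
Hypothesis tu : forall x, U x -> shifted A t x \in unitmx.

Let B := resolvent g A t.
Let chi := charpoly_at A t.
Let q := reduced_operator g Gam A mu t u.
Let dq x := \col_k opD_diff (g x) (h x) (H x) (lam x) (phi x) (Dh x) (B x) k.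

Lemma contravariantE x : U x -> \adj (shifted A t x) *m G x = chi x *: B x.
Proof.
move=> Ux; have S := tu Ux; rewrite scalemxAl; congr (_ *m _).
by rewrite /invmx S scalerA divff ?scale1r // -unitfE -unitmxE.
Qed.

Lemma operator_reduced x : U x -> Q t u x = chi x * q x.
Proof.
move=> Ux; rewrite -(divg_resolvent_grad oU sg gT gu metric sA gA nabA tu su Ux).
by apply: (eq_divg oU _ _ Ux) => y Uy; rewrite contravariantE.
Qed.

(** The bracket is g B, the inverse of t - A^T, applied to the left side of [grad_identity]. *)
Lemma grad_operator x : U x ->
  grad (Q t u) x = chi x *: (dq x - (2 * q x) *: (g x *m (B x *m lam x))).
Proof.
move=> Ux; apply/colP => k; rewrite [LHS]mxE (eq_partial oU k operator_reduced Ux).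
have sq := smooth_reduced_operator oU sg gu sGam sA smu tu su.
have schi := smooth_charpoly oU sA t.
rewrite (partialM k schi sq Ux).
rewrite (partial_charpoly oU gT gu sA gA nabA tu k Ux).
rewrite (partial_reduced_operator oU sg gT gu sGam metric sA smu gA nabA tu su k Ux).
rewrite dot_ev !entryE [dq x k 0]mxE -/lam -/q -/chi -/B -/phi -/h -/H.
move: (opD_diff _ _ _ _ _ _ _ _) (chi x) (q x) ((_ *m _) k 0) => a b c d; ring.
Qed.

Lemma grad_identity x : U x ->
  (t%:M - (A x)^T) *m dq x - (2 * q x) *: lam x
  = resolvent_rhs (g x) (omega x) (lam x) (\col_k \tr (G x *m Dh x k)) (D_omega x) (B x).
Proof.
move=> Ux.
have hT : (h x)^T = h x := hess_sym oU torsion_free su Ux.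
have HT : (H x)^T = H x := hess_sym oU torsion_free smu Ux.
have DhT k : (Dh x k)^T = Dh x k.
  have E y : U y -> h y = (h y)^T by move=> Uy; exact: (esym (hess_sym oU torsion_free su Uy)).
  rewrite /Dh -[in LHS](nab_tr oU Gam' Gam k h Ux) /Gam' dual_connK -/Gam'.
  by rewrite -(eq_nab oU Gam' Gam k E Ux).
have Dhc k j : Dh x k *m ev j - Dh x j *m ev k = - ((curv Gam k j x)^T *m phi x).
  exact: (hess_commutator oU sGam torsion_free k j su Ux).
have Rs k l : (curv Gam k l x)^T *m g x = - (g x *m curv Gam k l x).
  exact: (curv_skew oU sg sGam metric k l Ux).
have Rb j k l : curv Gam k j x *m ev l + curv Gam j l x *m ev k + curv Gam l k x *m ev j = 0.
  exact: (curv_bianchi oU torsion_free).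
have RA l k := curv_compatible oU sg gu sGam torsion_free metric sA smu compatible l k Ux.
exact: (resolvent_identity (lam x) (gG Ux) (gT Ux) (gA Ux) hT HT DhT Dhc
  (fun k l => curv_alt Gam k l x) Rs Rb RA (resolvent_sym gT gu gA tu Ux) (resolventK g tu Ux)).
Qed.

End OneParameter.

Section TwoParameters.
Variables v w : R.
Hypothesis vu : forall x, U x -> shifted A v x \in unitmx.
Hypothesis wu : forall x, U x -> shifted A w x \in unitmx.
Hypothesis vw : v != w.

Let B := resolvent g A v.
Let C := resolvent g A w.
Let chi := charpoly_at A v.
Let psi := charpoly_at A w.
Let E x := B x - C x.
Let sB : smooth_mx_on U B. Proof. exact: (smooth_resolvent oU sg gu sA vu). Qed.
Let sC : smooth_mx_on U C. Proof. exact: (smooth_resolvent oU sg gu sA wu). Qed.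
Let sE : smooth_mx_on U E. Proof. exact: (smooth_mxB oU sB sC). Qed.

Definition potential_bivector x : 'M[R]_n :=
  ((w - v)^-1 * (chi x * psi x)) *: (E x *m omega x *m E x).

Let sc : smooth_on U (fun x => (w - v)^-1 * (chi x * psi x)).
Proof.
by apply: (smoothM oU (smooth_cst oU _)); apply: (smoothM oU); exact: (smooth_charpoly oU sA).
Qed.

Lemma smooth_potential_bivector : smooth_mx_on U potential_bivector.
Proof. exact: (smooth_mxZ oU sc (smooth_mxM oU (smooth_mxM oU sE smooth_omega) sE)). Qed.

Lemma potential_bivector_skew x : U x -> (potential_bivector x)^T = - potential_bivector x.
Proof.
move=> Ux; have BT : (B x)^T = B x := resolvent_sym gT gu gA vu Ux.
have CT : (C x)^T = C x := resolvent_sym gT gu gA wu Ux.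
have ET : (E x)^T = E x by rewrite /E trmxE trmxE BT CT.
rewrite /potential_bivector trmxE !trmx_mul ET omega_skew // mulNmx mulmxN scalerN.
by rewrite mulmxA.
Qed.

(** [pair_identity] multiplied by the scalar factor of the bivector; the derivative of that factor
    accounts for the last term there. *)
Lemma grad_exchange x : U x ->
  \adj (shifted A v x) *m G x *m grad (Q w u) x - \adj (shifted A w x) *m G x *m grad (Q v u) x
  = div2 Gam potential_bivector x.
Proof.
move=> Ux; rewrite (contravariantE vu Ux) (contravariantE wu Ux) (grad_operator vu Ux) (grad_operator wu Ux).
have BT : (B x)^T = B x := resolvent_sym gT gu gA vu Ux.
have CT : (C x)^T = C x := resolvent_sym gT gu gA wu Ux.
have P := pair_identity (gG Ux) (gT Ux) (gA Ux) (omega_skew Ux) BT (resolventK g vu Ux)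
  CT (resolventK g wu Ux) vw (grad_identity vu Ux) (grad_identity wu Ux).
have wv : w - v != 0 by rewrite subr_eq0 eq_sym.
pose c := (w - v)^-1 * (chi x * psi x).
(* Each product has chi from one factor and psi from the other, so chi psi comes out; w - v is
   inserted to match [pair_identity]. *)
have L (a b : R) (M N : 'M[R]_n) (X Y : 'cV[R]_n) :
    (a *: M) *m (b *: X) - (b *: N) *m (a *: Y) = (w - v)^-1 * (a * b) *: ((w - v) *: (M *m X - N *m Y)).
  rewrite scalerA mulrAC mulVf // mul1r !scalerBr -!scalemxAl -!scalemxAr !scalerA.
  by rewrite [b * a]mulrC.
rewrite L P -/(chi x) -/(psi x) -/c -/(E x).
have nE k : nab Gam Gam' k E x = DB (g x) (lam x) (B x) k - DB (g x) (lam x) (C x) k.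
  rewrite (nabB oU Gam Gam' k sB sC Ux).
  rewrite (nab_resolvent oU sg gT gu metric sA gA nabA vu k Ux).
  by rewrite (nab_resolvent oU sg gT gu metric sA gA nabA wu k Ux).
have pc k : partial k (fun y => (w - v)^-1 * (chi y * psi y)) x =
    - (2 * c * (g x *m (B x *m lam x) + g x *m (C x *m lam x)) k 0).
  have s1 := smooth_charpoly oU sA v; have s2 := smooth_charpoly oU sA w.
  rewrite (partialZ oU k _ (smoothM oU s1 s2) Ux) (partialM k s1 s2 Ux).
  rewrite (partial_charpoly oU gT gu sA gA nabA vu k Ux) (partial_charpoly oU gT gu sA gA nabA wu k Ux).
  rewrite !dot_ev /c entryE -/chi -/psi -/B -/C -/lam.
  by move: ((w - v)^-1) (chi x) (psi x) ((_ *m _) k 0) ((_ *m _) k 0) => a b d e f; ring.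
have nF k : nab Gam Gam' k potential_bivector x *m ev k =
    c *: (((DB (g x) (lam x) (B x) k - DB (g x) (lam x) (C x) k) *m omega x *m E x
      + E x *m D_omega x k *m E x
      + E x *m omega x *m (DB (g x) (lam x) (B x) k - DB (g x) (lam x) (C x) k)) *m ev k)
    - (2 * c) *: ((g x *m (B x *m lam x) + g x *m (C x *m lam x)) k 0 *: (E x *m omega x *m E x *m ev k)).
  have sEO := smooth_mxM oU sE smooth_omega.
  rewrite (nabZ oU Gam Gam' k sc (smooth_mxM oU sEO sE) Ux) pc.
  rewrite (nabM oU Gam Gam Gam' k sEO sE Ux) (nabM oU Gam Gam' Gam k sE smooth_omega Ux).
  rewrite nE nab_omega // -/c [LHS]mulmxDl -!scalemxAl addrC; congr (_ *: (_ *m _) + _).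
    by rewrite (mulmxDl _ _ (E x)).
  by rewrite scalerA scaleNr.
rewrite /div2 (eq_bigr _ (fun k _ => nF k)) sumrB -!scaler_sumr sum_mul_ev.
by rewrite scalerBr scalerA [c * 2]mulrC.
Qed.

Theorem contravariant_operators_commute x : U x -> Q v (Q w u) x = Q w (Q v u) x.
Proof.
move=> Ux; apply/eqP; rewrite -subr_eq0; apply/eqP.
have sY a b : smooth_mx_on U (fun y => \adj (shifted A a y) *m G y *m grad (Q b u) y).
  exact: (smooth_mxM oU (smooth_contravariant a) (smooth_grad oU (smooth_contravariant_operator b su))).
rewrite -(divgB oU Gam (sY v w) (sY w v) Ux).
rewrite (eq_divg oU Gam grad_exchange Ux).
exact: (divg_div2 oU sGam torsion_free (trace_conn_closed oU sg gu sGam metric)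
  smooth_potential_bivector potential_bivector_skew Ux).
Qed.

End TwoParameters.
End LocalCommutation.

(** * Interpolation in the parameter *)

Section Interpolation.
Context {F : fieldType}.

(** The weights solve a Vandermonde system and depend on the nodes and v alone, not on p; over a
    manifold they are therefore constants. *)
Lemma interpolation_weights (r : seq F) (v : F) : uniq r ->
  exists c : 'I_(size r) -> F, forall p : {poly F}, (size p <= size r)%N ->
    p.[v] = \sum_i c i * p.[r`_i].
Proof.
move=> ur; set N := size r.
pose a := \row_(i < N) r`_i; pose V := Vandermonde N a.
have Vu : V \in unitmx.
  rewrite unitmxE unitfE det_Vandermonde; apply/prodf_neq0 => i _; apply/prodf_neq0 => j ij.
  by rewrite !mxE subr_eq0 nth_uniq // gt_eqF.
pose c := invmx V *m \col_k v ^+ k.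
exists (fun i => c i 0) => p pN.
have Vc (k : 'I_N) : \sum_i c i 0 * r`_i ^+ k = v ^+ k.
  have /colP/(_ k) : V *m c = \col_k v ^+ k by rewrite mulmxA mulmxV // mul1mx.
  by rewrite !mxE => <-; apply: eq_bigr => i _; rewrite !mxE mulrC.
rewrite (horner_coef_wide _ pN); under eq_bigr do rewrite -Vc big_distrr /=.
rewrite exchange_big; apply: eq_bigr => i _ /=.
rewrite (horner_coef_wide _ pN) big_distrr; apply: eq_bigr => k _ /=; exact: mulrCA.
Qed.

Lemma horner_char_poly_mx n (A : 'M[F]_n) t :
  map_mx (horner_eval t) (char_poly_mx A) = t%:M - A.
Proof.
by apply/matrixP => a b; rewrite !mxE /horner_eval hornerD hornerN hornerMn hornerX hornerC.
Qed.

Lemma horner_char_poly n (A : 'M[F]_n) t : (char_poly A).[t] = \det (t%:M - A).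
Proof. by rewrite -horner_char_poly_mx det_map_mx. Qed.

Lemma horner_adj_char_poly_mx n (A : 'M[F]_n) t i j :
  (\adj (char_poly_mx A) i j).[t] = \adj (t%:M - A) i j.
Proof. by rewrite -horner_char_poly_mx -map_mx_adj [RHS]mxE. Qed.

(** The entries are minors of order n - 1 with linear entries, so the degree is in fact at most n -
    1; the bound n suffices, as the number of nodes can be chosen freely. *)
Lemma size_adj_char_poly_mx n (A : 'M[F]_n) i j : (size (\adj (char_poly_mx A) i j) <= n.+1)%N.
Proof.
have H m (M : 'M[{poly F}]_m) : (forall a b, size (M a b) <= 2)%N -> (size (\det M) <= m.+1)%N.
  move=> sM; apply: leq_trans (size_sum _ _ _) _; apply/bigmax_leqP => s _.
  rewrite size_Msign; apply: leq_trans (size_poly_prod_leq _ _) _.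
  rewrite cardT size_enum_ord leq_subLR addnS ltnS addnn -muln2 -[X in (_ <= X * _)%N]card_ord.
  by rewrite -sum_nat_const; apply: leq_sum.
rewrite mxE size_Msign.
case: n A i j => [|n] A i j; first by case: i.
apply: leq_trans (H _ _ _) _ => // a b; rewrite !mxE.
apply: leq_trans (size_polyD _ _) _; rewrite geq_max size_polyN.
rewrite (leq_trans (size_polyC_leq1 _)) // andbT.
by case: (_ == _); rewrite ?size_polyX ?size_poly0.
Qed.

End Interpolation.

(** Among N + size p natural numbers, distinct in characteristic zero, fewer than size p are
    roots. *)
Lemma nonroots (R : numFieldType) (p : {poly R}) N : p != 0 ->
  exists r : seq R, [/\ uniq r, size r = N & all (fun x => ~~ root p x) r].
Proof.
move=> p0; pose s := [seq k%:R : R | k <- iota 0 (N + size p)].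
have us : uniq s.
  by rewrite map_inj_uniq ?iota_uniq // => a b /eqP; rewrite eqr_nat => /eqP.
pose r := [seq x <- s | ~~ root p x].
have sr : (N <= size r)%N.
  rewrite size_filter -(leq_add2r (count (root p) s)) addnC.
  have -> : (count (fun x => ~~ root p x) s + count (root p) s = N + size p)%N.
    by rewrite addnC count_predC size_map size_iota.
  rewrite addnC leq_add2l -size_filter; apply/ltnW/max_poly_roots => //.
    exact: filter_all.
  exact: filter_uniq.
exists (take N r); split; first by rewrite take_uniq // filter_uniq.
  by rewrite size_takel.
have /allP H := filter_all (fun x => ~~ root p x) s.
by apply/allP => x /mem_take /H.
Qed.

(** * Divergence and differential of constant linear combinations *)

Section LinearCombinations.
Context {R : realType} {n : nat}.
Variable U : set 'rV[R]_n.
Hypothesis oU : open U.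
Implicit Types (x : 'rV[R]_n).

Lemma divg_lincomb (Gam : @connection R n n) (I : finType) (c : I -> R) (V : I -> 'rV[R]_n -> 'cV[R]_n) x :
  (forall i, smooth_mx_on U (V i)) -> U x ->
  divg Gam (fun y => \sum_i c i *: V i y) x = \sum_i c i * divg Gam (V i) x.
Proof.
move=> sV Ux; under [RHS]eq_bigr do rewrite divgE big_distrr /=.
rewrite exchange_big divgE; apply: eq_bigr => j _ /=.
under [RHS]eq_bigr do rewrite mulrDr; rewrite big_split /=; congr (_ + _).
  rewrite (@eq_partial _ _ _ oU _ (fun y => \sum_i c i * V i y j 0) j x _ Ux); last first.
    by move=> y _; rewrite summxE; apply: eq_bigr => i _; rewrite mxE.
  rewrite (partial_sum oU _ j _ Ux) => [|i]; last exact: (smoothM oU (smooth_cst oU _) (sV i j 0)).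
  by apply: eq_bigr => i _; rewrite (partialZ oU j (c i) (sV i j 0) Ux).
rewrite mulmx_sumr summxE; apply: eq_bigr => i _.
by rewrite -scalemxAr entryE.
Qed.

Lemma grad_lincomb (I : finType) (c : I -> R) (f : I -> 'rV[R]_n -> R) x :
  (forall i, smooth_on U (f i)) -> U x ->
  grad (fun y => \sum_i c i * f i y) x = \sum_i c i *: grad (f i) x.
Proof.
move=> sf Ux; apply/colP => j; rewrite [LHS]mxE summxE.
rewrite (partial_sum oU _ j _ Ux) => [|i]; last exact: (smoothM oU (smooth_cst oU _) (sf i)).
by apply: eq_bigr => i _; rewrite (partialZ oU j (c i) (sf i) Ux) entryE mxE.
Qed.

Lemma eq_grad (u v : 'rV[R]_n -> R) x : (forall y, U y -> u y = v y) -> U x -> grad u x = grad v x.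
Proof. by move=> uv Ux; apply/colP => i; rewrite !mxE; exact: (eq_partial oU). Qed.

End LinearCombinations.

Lemma quantum_integral_locE (R : realType) n (g A : 'rV[R]_n -> 'M[R]_n) t u x :
  quantum_integral_loc g A t u x = - contravariant_operator g (levi_civita g) A t u x.
Proof.
rewrite /quantum_integral_loc /contravariant_operator divgE; congr (- _).
apply: eq_bigr => j _; rewrite /nabla_vector.
have E i : (fun y => \sum_k Killing g A t y i k * partial k u y) =
    (fun y => (\adj (shifted A t y) *m invmx (g y) *m grad u y) i 0).
  by apply/funext => y; rewrite [RHS]mxE; apply: eq_bigr => k _; rewrite [grad _ _ _ _]mxE.
rewrite E; congr (_ + _); rewrite [RHS]mxE; apply: eq_bigr => l _.
by rewrite [levi_civita _ _ _ _ _]mxE; congr (_ * _); exact: (congr1 (fun f => f x) (E l)).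
Qed.

(** * Commutation in one chart for all parameters *)

Section ChartCommutation.
Context {R : realType} {n : nat}.
Variable U : set 'rV[R]_n.
Hypothesis oU : open U.
Variables g A : 'rV[R]_n -> 'M[R]_n.
Hypothesis sg : smooth_mx_on U g.
Hypothesis gT : forall x, U x -> (g x)^T = g x.
Hypothesis gu : forall x, U x -> g x \in unitmx.
Hypothesis sA : smooth_mx_on U A.
Hypothesis gAT : forall x, U x -> (lower_index g A x)^T = lower_index g A x.
Hypothesis compatible : forall x k i j, U x ->
  nabla_tensor02 g (lower_index g A) k i j x =
  partial i (half_trace A) x * g x j k + partial j (half_trace A) x * g x i k.
Implicit Types (x : 'rV[R]_n) (t : R).

Let Gam := levi_civita g.
Let mu := half_trace A.
Let Q := contravariant_operator g Gam A.

Lemma smooth_half_trace : smooth_on U mu.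
Proof. exact: (smoothM oU (smooth_cst oU _) (smooth_mxtrace oU sA)). Qed.

Lemma nab_lower_index k x : U x ->
  nab (dual_conn Gam) Gam k (fun y => g y *m A y) x =
  grad mu x *m (g x *m ev k)^T + g x *m ev k *m (grad mu x)^T.
Proof.
move=> Ux; apply/matrixP => i j.
have -> : (grad mu x *m (g x *m ev k)^T + g x *m ev k *m (grad mu x)^T) i j =
   partial i mu x * g x j k + partial j mu x * g x i k.
  rewrite entryE ![(_ *m _^T) i j]mxE !big_ord1 ![_^T _ _]mxE !mul_evE.
  by rewrite ![grad _ _ _ _]mxE [g x i k * _]mulrC.
rewrite -compatible // /nab /nabla_tensor02 /dual_conn mulNmx !entryE; congr (_ - _ - _).
- by rewrite mxE.
- by rewrite mxE; apply: eq_bigr => l _; rewrite [_^T _ _]mxE [Gam _ _ _ _]mxE.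
- by rewrite mxE; apply: eq_bigr => l _; rewrite [Gam _ _ _ _]mxE mulrC.
Qed.

(** Invertibility at x persists nearby by continuity of the determinant, and all data are restricted
    to that neighbourhood W. *)
Lemma contravariant_operators_commute_generic v w u x :
  smooth_on U u -> U x -> shifted A v x \in unitmx -> shifted A w x \in unitmx ->
  Q v (Q w u) x = Q w (Q v u) x.
Proof.
(* Equal parameters are set aside because the bivector carries the factor 1 / (w - v). *)
move=> su Ux vx wx; have [->//|vw] := eqVneq v w.
pose W := [set y | [/\ U y, shifted A v y \in unitmx & shifted A w y \in unitmx]].
have near_unit t y : U y -> shifted A t y \in unitmx -> \forall z \near y, shifted A t z \in unitmx.
  move=> Uy; rewrite unitmxE unitfE => d0.
  have cd : {for y, continuous (charpoly_at A t)}.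
    exact: (smooth_continuous (smooth_charpoly oU sA t) Uy).
  have : \forall z \near y, charpoly_at A t z != 0 by exact: (cvgr_neq0 _ cd d0).
  by apply: filterS => z; rewrite unitmxE unitfE.
have oW : open W.
  rewrite openE => y [Uy vy wy]; rewrite /interior.
  apply: filterS (filterI (open_nbhs_nbhs (conj oU Uy)) (filterI (near_unit _ _ Uy vy) (near_unit _ _ Uy wy))).
  by move=> z [? [? ?]].
have WU y : W y -> U y by case.
have sub m p (B : 'rV[R]_n -> 'M[R]_(m, p)) : smooth_mx_on U B -> smooth_mx_on W B.
  by move=> sB i j; exact: smooth_subset (sB i j).
apply: (@contravariant_operators_commute _ _ W oW g (sub _ _ _ sg) (fun y Wy => gT (WU y Wy))
  (fun y Wy => gu (WU y Wy)) Gam _ (fun k j y Wy => levi_civita_torsion oU gT k j (WU y Wy))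
  (fun k y Wy => levi_civita_metric oU gT gu k (WU y Wy)) A mu (sub _ _ _ sA)
  (smooth_subset WU smooth_half_trace) (fun y Wy => gAT (WU y Wy))
  (fun k y Wy => nab_lower_index k (WU y Wy)) u (smooth_subset WU su) v w _ _ vw x) => //.
- by move=> k; apply: sub; exact: (smooth_levi_civita oU sg gu).
- by move=> y [].
- by move=> y [].
Qed.

(** The nodes are n + 1 numbers that are not eigenvalues of A at x. Both compositions at x become
    double sums over pairs of nodes, to which the generic case applies. *)
Lemma contravariant_operators_commute_all v w u x :
  smooth_on U u -> U x -> Q v (Q w u) x = Q w (Q v u) x.
Proof.
move=> su Ux.
have p0 : char_poly (A x) != 0 by rewrite -size_poly_eq0 size_char_poly.
have [r [ur sr rr]] := nonroots n.+1 p0.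
have runit (i : 'I_(size r)) : shifted A r`_i x \in unitmx.
  by rewrite unitmxE unitfE -horner_char_poly; have /(all_nthP 0)/(_ i (ltn_ord i)) := rr.
(* The expansion must hold on all of U and not only at x, since the inner operator gets
   differentiated. *)
have K t : exists c : 'I_(size r) -> R, forall f y, smooth_on U f -> U y ->
    Q t f y = \sum_i c i * Q r`_i f y.
  have [c cE] := interpolation_weights t ur; exists c => f y sf Uy.
  pose V s z := \adj (shifted A s z) *m invmx (g z) *m grad f z.
  have sV s : smooth_mx_on U (V s).
    exact: (smooth_mxM oU (smooth_contravariant oU sg gu sA s) (smooth_grad oU sf)).
  rewrite /Q /contravariant_operator -(divg_lincomb oU Gam c (fun i => sV r`_i) Uy).
  apply: (eq_divg oU _ _ Uy) => z Uz.
  have -> : \adj (shifted A t z) = \sum_i c i *: \adj (shifted A r`_i z).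
    apply/matrixP => a b; rewrite summxE -horner_adj_char_poly_mx cE.
      by apply: eq_bigr => i _; rewrite entryE horner_adj_char_poly_mx.
    by rewrite sr size_adj_char_poly_mx.
  by rewrite !mulmx_suml; apply: eq_bigr => i _; rewrite -!scalemxAl.
have sQ t f : smooth_on U f -> smooth_on U (Q t f).
  exact: (smooth_contravariant_operator oU sg gu (smooth_levi_civita oU sg gu) sA).
have lin t (c : 'I_(size r) -> R) (f : 'I_(size r) -> 'rV[R]_n -> R) F :
    (forall i, smooth_on U (f i)) -> (forall y, U y -> F y = \sum_i c i * f i y) ->
    Q t F x = \sum_i c i * Q t (f i) x.
  move=> sf FE; pose V i z := \adj (shifted A t z) *m invmx (g z) *m grad (f i) z.
  have sV i : smooth_mx_on U (V i).
    exact: (smooth_mxM oU (smooth_contravariant oU sg gu sA t) (smooth_grad oU (sf i))).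
  rewrite /Q /contravariant_operator -(divg_lincomb oU Gam c sV Ux).
  apply: (eq_divg oU _ _ Ux) => z Uz.
  rewrite (eq_grad oU FE Uz) (grad_lincomb oU c sf Uz) mulmx_sumr.
  by apply: eq_bigr => i _; rewrite -scalemxAr.
have [c cE] := K v; have [d dE] := K w.
have E t s (a b : 'I_(size r) -> R) : (forall f y, smooth_on U f -> U y -> Q t f y = \sum_i a i * Q r`_i f y) ->
   (forall f y, smooth_on U f -> U y -> Q s f y = \sum_i b i * Q r`_i f y) ->
   Q t (Q s u) x = \sum_i \sum_j a i * b j * Q r`_i (Q r`_j u) x.
  move=> aE bE; rewrite (aE _ _ (sQ s u su) Ux); apply: eq_bigr => i _.
  transitivity (a i * \sum_j b j * Q r`_i (Q r`_j u) x).
    congr (_ * _).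
    exact: (lin r`_i b (fun j => Q r`_j u) (Q s u) (fun j => sQ r`_j u su) (fun y Uy => bE u y su Uy)).
  by rewrite big_distrr; apply: eq_bigr => j _ /=; rewrite mulrA.
rewrite (E _ _ _ _ cE dE) (E _ _ _ _ dE cE) exchange_big; apply: eq_bigr => i _.
apply: eq_bigr => j _; rewrite [c _ * _]mulrC.
by rewrite (contravariant_operators_commute_generic su Ux (runit j) (runit i)).
Qed.

Theorem quantum_integrals_loc_commute v w u x : smooth_on U u -> U x ->
  quantum_integral_loc g A v (quantum_integral_loc g A w u) x =
  quantum_integral_loc g A w (quantum_integral_loc g A v u) x.
Proof.
move=> su Ux.
have E s t : contravariant_operator g (levi_civita g) A s (quantum_integral_loc g A t u) x
    = - Q s (Q t u) x.
  have -> : quantum_integral_loc g A t u = fun y => - Q t u y.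
    by apply/funext => y; exact: (quantum_integral_locE g A t u y).
  have sQ := smooth_contravariant_operator oU sg gu (smooth_levi_civita oU sg gu) sA t su.
  have sV : smooth_mx_on U (fun y => \adj (shifted A s y) *m invmx (g y) *m grad (Q t u) y).
    exact: (smooth_mxM oU (smooth_contravariant oU sg gu sA s) (smooth_grad oU sQ)).
  apply: (etrans _ (divgN oU Gam sV Ux)).
  apply: (eq_divg oU _ _ Ux) => z Uz; rewrite -mulmxN; congr (_ *m _).
  by apply/colP => i; rewrite entryE !mxE (partialN i sQ Uz).
have F s t : quantum_integral_loc g A s (quantum_integral_loc g A t u) x = Q s (Q t u) x.
  exact: (etrans (quantum_integral_locE g A s _ x) (etrans (congr1 -%R (E s t)) (opprK _))).
exact: (etrans (F v w) (etrans (contravariant_operators_commute_all v w su Ux) (esym (F w v)))).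
Qed.

End ChartCommutation.

(** The logarithmic derivative of det (J K J^T), where P and S stand for the derivatives of J and K:
    each of the two factors J contributes the trace of J^-1 P. *)
Lemma trace_congruence (R : fieldType) n (J K P S : 'M[R]_n) : J \in unitmx -> K \in unitmx ->
  \tr (invmx J^T *m invmx K *m invmx J *m ((P *m K + J *m S) *m J^T + J *m K *m P^T)) =
  2 * \tr (invmx J *m P) + \tr (invmx K *m S).
Proof.
move=> Ju Ku; have JTu : J^T \in unitmx by rewrite unitmx_tr.
rewrite mulmxDl !mulmxDr !raddfD /=.
have -> : \tr (invmx J^T *m invmx K *m invmx J *m (P *m K *m J^T)) = \tr (invmx J *m P).
  by rewrite mxtrace_mulC !mulmxA mulmxK // mulmxK // mxtrace_mulC.
have -> : \tr (invmx J^T *m invmx K *m invmx J *m (J *m S *m J^T)) = \tr (invmx K *m S).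
  by rewrite mxtrace_mulC !mulmxA mulmxK // mxtrace_mulC !mulmxA mulVmx // mul1mx mxtrace_mulC.
have -> : \tr (invmx J^T *m invmx K *m invmx J *m (J *m K *m P^T)) = \tr (invmx J *m P).
  rewrite !mulmxA mulmxKV // mulmxKV // -trmx_inv -trmx_mul mxtrace_tr; exact: mxtrace_mulC.
move: (\tr _) (\tr _) => a b; ring.
Qed.

(** * Invariance of the operator under a change of chart *)

Section ChartChange.
Context {R : realType} {n : nat}.
Variables O O' : set 'rV[R]_n.
Hypotheses (oO : open O) (oO' : open O').
Variable F : 'rV[R]_n -> 'rV[R]_n.
Hypothesis sF : smooth_mx_on O F.
Hypothesis FO : forall x, O x -> O' (F x).
Variables (g A g' A' : 'rV[R]_n -> 'M[R]_n).
Hypotheses (sg : smooth_mx_on O g) (sg' : smooth_mx_on O' g').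
Hypotheses (sA : smooth_mx_on O A) (sA' : smooth_mx_on O' A').
Hypotheses (gT : forall x, O x -> (g x)^T = g x) (gu : forall x, O x -> g x \in unitmx).
Hypotheses (gT' : forall x, O' x -> (g' x)^T = g' x) (gu' : forall x, O' x -> g' x \in unitmx).
Hypothesis g_change : forall x, O x -> g x = 'J F x *m g' (F x) *m ('J F x)^T.
Hypothesis A_change : forall x, O x -> ('J F x)^T *m A x = A' (F x) *m ('J F x)^T.
Implicit Types (x : 'rV[R]_n) (i j k l : 'I_n).

Let J x := 'J F x.

Lemma dmx_comp m p (B : 'rV[R]_n -> 'M[R]_(m, p)) l x : smooth_mx_on O' B -> O x ->
  dmx l (B \o F) x = \sum_k J x l k *: dmx k B (F x).
Proof.
move=> sB Ox; apply/matrixP => i j; rewrite [LHS]mxE summxE.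
rewrite (partial_comp oO oO' sF FO l (sB i j) Ox).
by apply: eq_bigr => k _; rewrite entryE [dmx _ _ _ _ _]mxE.
Qed.

Lemma smooth_jacobian : smooth_mx_on O J.
Proof.
move=> i j; apply: (eq_smooth oO) (smooth_partial i (sF 0 j)) => y Oy.
by rewrite (jacobianE oO sF).
Qed.

Lemma partial_jacobian_sym l i k x : O x -> dmx l J x i k = dmx i J x l k.
Proof.
move=> Ox.
have E a b : dmx a J x b k = partial a (partial b (fun y => F y 0 k)) x.
  by rewrite [LHS]mxE; apply: (eq_partial oO _ _ Ox) => y Oy; rewrite (jacobianE oO sF).
exact: (etrans (E l i) (etrans (partialC oO l i (sF 0 k) Ox) (esym (E i l)))).
Qed.

(** J is a factor of the invertible matrix g = J g' J^T. *)
Lemma jacobian_unit x : O x -> J x \in unitmx.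
Proof. by move=> Ox; have := gu Ox; rewrite g_change // !unitmx_mul => /andP[/andP[]]. Qed.

Lemma inverse_change x : O x -> invmx (g' (F x)) = (J x)^T *m invmx (g x) *m J x.
Proof.
move=> Ox; have Ju := jacobian_unit Ox.
have E : (J x)^T *m invmx (g x) *m J x *m g' (F x) = 1%:M.
  apply: (can_inj (mulmxK (_ : (J x)^T \in unitmx))); first by rewrite unitmx_tr.
  rewrite mul1mx -!mulmxA (mulmxA (J x)) -g_change // mulVmx ?mulmx1 //.
  exact: gu.
by rewrite -[LHS]mul1mx -E mulmxK // gu' //; exact: FO.
Qed.

(** When t is an eigenvalue, t - A cannot be cancelled. Over polynomials the characteristic matrix
    has nonzero determinant, so the identity is proved there and then evaluated at t. *)
Lemma adj_similar t x : O x ->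
  (J x)^T *m \adj (shifted A t x) = \adj (shifted A' t (F x)) *m (J x)^T.
Proof.
move=> Ox; pose X := map_mx (@polyC R) (J x)^T.
pose S := char_poly_mx (A x); pose S' := char_poly_mx (A' (F x)).
have XS : X *m S = S' *m X.
  rewrite /S /S' mulmxBr mulmxBl scalar_mxC; congr (_ - _).
  by rewrite -!map_mxM A_change.
have dS : \det S = \det S'.
  have dX : \det X != 0.
    by rewrite det_map_mx polyC_eq0 -unitfE -unitmxE unitmx_tr jacobian_unit.
  by apply: (mulfI dX); rewrite -det_mulmx XS det_mulmx mulrC.
have E : X *m \adj S = \adj S' *m X.
  have d0 : \det S != 0 by rewrite -size_poly_eq0 size_char_poly.
  have : \adj S' *m X *m S *m \adj S = \adj S' *m S' *m X *m \adj S by rewrite -!mulmxA (mulmxA X) XS -mulmxA.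
  rewrite mul_adj_mx -dS -(mulmxA _ S) mul_mx_adj mul_mx_scalar -mulmxA mul_scalar_mx.
  move/matrixP => Eij; apply/matrixP => i j; have := Eij i j; rewrite !entryE.
  by move/(mulfI d0)/esym.
have H (M : 'M[{poly R}]_n) : map_mx (horner_eval t) M = map_mx (horner_eval t) M by [].
have XJ : map_mx (horner_eval t) X = (J x)^T.
  by apply/matrixP => i j; rewrite !mxE /horner_eval hornerC.
have := congr1 (map_mx (horner_eval t)) E; rewrite !map_mxM XJ !map_mx_adj.
by rewrite !horner_char_poly_mx.
Qed.

(** The formula with density sqrt |det h|, written through its logarithmic derivative, so that
    neither a root nor the sign of the determinant appears. *)
Lemma levi_civita_divergence (U : set 'rV[R]_n) h V x : open U ->
  smooth_mx_on U h -> (forall x, U x -> (h x)^T = h x) -> (forall x, U x -> h x \in unitmx) -> U x ->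
  divg (levi_civita h) V x =
  \sum_j partial j (fun y => V y j 0) x + 2^-1 * \sum_l \tr (invmx (h x) *m dmx l h x) * V x l 0.
Proof.
move=> oU sh hT hu Ux; rewrite divgE big_split /=; congr (_ + _).
rewrite (sum_conn_row (levi_civita_torsion oU hT) V Ux) big_distrr; apply: eq_bigr => l _ /=.
rewrite mulrA; congr (_ * _).
have := levi_civita_metric oU hT hu l Ux; rewrite /nab /dual_conn mulNmx => /eqP.
rewrite subr_eq add0r subr_eq => /eqP ->.
rewrite mulmxDr raddfD /= !mulmxA mulVmx ?hu // mul1mx.
rewrite -mulmxA mxtrace_mulC -mulmxA mulmxV ?hu // mulmx1 mxtrace_tr.
by move: (\tr _) => a; field.
Qed.

Variables (t : R) (u u' : 'rV[R]_n -> R).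
Hypotheses (su : smooth_on O u) (su' : smooth_on O' u').
Hypothesis uE : forall x, O x -> u x = u' (F x).

Let V x := \adj (shifted A t x) *m invmx (g x) *m grad u x.
Let V' x := \adj (shifted A' t x) *m invmx (g' x) *m grad u' x.
Let sV : smooth_mx_on O V.
Proof. exact: (smooth_mxM oO (smooth_contravariant oO sg gu sA t) (smooth_grad oO su)). Qed.
Let sV' : smooth_mx_on O' V'.
Proof. exact: (smooth_mxM oO' (smooth_contravariant oO' sg' gu' sA' t) (smooth_grad oO' su')). Qed.

Lemma grad_change x : O x -> grad u x = J x *m grad u' (F x).
Proof.
move=> Ox; apply/colP => i; rewrite [LHS]mxE [RHS]mxE (eq_partial oO i uE Ox).
rewrite (partial_comp oO oO' sF FO i su' Ox); apply: eq_bigr => j _.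
by rewrite [grad _ _ _ _]mxE.
Qed.

Lemma flux_change x : O x -> V' (F x) = (J x)^T *m V x.
Proof.
move=> Ox; rewrite /V /V' inverse_change // grad_change // !mulmxA.
by rewrite adj_similar.
Qed.

(** Two corrections cancel: the trace of the derivative of the flux gains c, the trace of J^-1 dJ
    along V, while the metric term loses 2 c, with weight 1/2, because g = J g' J^T contains J
    twice. *)
Lemma quantum_integral_loc_change x : O x ->
  quantum_integral_loc g A t u x = quantum_integral_loc g' A' t u' (F x).
Proof.
move=> Ox; have Ju := jacobian_unit Ox.
pose D := \matrix_(l, i) partial l (fun y => V y i 0) x.
pose D' := \matrix_(l, i) partial l (fun y => V' y i 0) (F x).
pose c := \sum_l \tr (invmx (J x) *m dmx l J x) * V x l 0.
pose s := \sum_l \tr (invmx (g x) *m dmx l g x) * V x l 0.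
pose s' := \sum_k \tr (invmx (g' (F x)) *m dmx k g' (F x)) * V' (F x) k 0.
have L : quantum_integral_loc g A t u x = - (\tr D + 2^-1 * s).
  apply: (etrans (quantum_integral_locE g A t u x)); congr (- _).
  apply: (etrans (levi_civita_divergence V oO sg gT gu Ox)); congr (_ + _).
  by apply: eq_bigr => j _; rewrite [RHS]mxE.
have L' : quantum_integral_loc g' A' t u' (F x) = - (\tr D' + 2^-1 * s').
  apply: (etrans (quantum_integral_locE g' A' t u' (F x))); congr (- _).
  apply: (etrans (levi_civita_divergence V' oO' sg' gT' gu' (FO Ox))); congr (_ + _).
  by apply: eq_bigr => j _; rewrite [RHS]mxE.
apply: (etrans L (etrans _ (esym L'))).
have E1 : \tr D' = c + \tr D.
  (* The chain rule applied to [flux_change]; the extra term contains second derivatives of F, whose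
     symmetry later identifies its trace with c. *)
  have JD : J x *m D' = \matrix_(l, k) (\sum_i dmx l J x i k * V x i 0) + D *m J x.
    apply/matrixP => l k.
    have -> : (J x *m D') l k = partial l ((fun y => V' y k 0) \o F) x.
      rewrite (partial_comp oO oO' sF FO l (sV' k 0) Ox) mxE; apply: eq_bigr => m _.
      by rewrite [D' _ _]mxE.
    rewrite (@eq_partial _ _ _ oO _ (fun y => \sum_i J y i k * V y i 0) l x _ Ox); last first.
      by move=> y Oy; rewrite /= flux_change // mxE; apply: eq_bigr => i _; rewrite mxE.
    rewrite (partial_sum oO _ l _ Ox) => [|i]; last exact: (smoothM oO (smooth_jacobian i k) (sV i 0)).
    rewrite entryE mxE [(D *m _) _ _]mxE -big_split; apply: eq_bigr => i _ /=.
    rewrite (partialM l (smooth_jacobian i k) (sV i 0) Ox) [D _ _]mxE [dmx _ _ _ _ _]mxE.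
    by rewrite [J x i k * _]mulrC.
  have -> : D' = invmx (J x) *m (J x *m D') by rewrite mulmxA mulVmx // mul1mx.
  rewrite JD mulmxDr raddfD /= [X in _ + X]mxtrace_mulC -mulmxA mulmxV // mulmx1; congr (_ + _).
  rewrite /c /mxtrace.
  transitivity (\sum_k \sum_l \sum_i invmx (J x) k l * (dmx i J x l k * V x i 0)).
    apply: eq_bigr => k _; rewrite mxE; apply: eq_bigr => l _; rewrite mxE big_distrr.
    apply: eq_bigr => i _.
    exact: (congr1 (fun z => invmx (J x) k l * (z * V x i 0)) (partial_jacobian_sym l i k Ox)).
  rewrite [RHS](eq_bigr (fun i => \sum_k \sum_l invmx (J x) k l * (dmx i J x l k * V x i 0))).
    by rewrite [RHS]exchange_big; apply: eq_bigr => k _; rewrite exchange_big.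
  move=> i _; rewrite big_distrl; apply: eq_bigr => k _ /=; rewrite mxE big_distrl.
  by apply: eq_bigr => l _ /=; rewrite mulrA.
(* Smoothness of the composite is read off from g' o F = J^-1 g J^-T. *)
have sgF : smooth_mx_on O (g' \o F).
  have sJi := smooth_invmx oO jacobian_unit smooth_jacobian.
  apply: (eq_smooth_mx oO) (smooth_mxM oO (smooth_mxM oO sJi sg) (smooth_mx_tr oO sJi)) => y Oy /=.
  rewrite g_change // -/(J y) !mulmxA mulVmx ?jacobian_unit // mul1mx trmx_inv.
  by rewrite mulmxK // unitmx_tr jacobian_unit.
have E2 : s = 2 * c + s'.
  have T l : \tr (invmx (g x) *m dmx l g x) = 2 * \tr (invmx (J x) *m dmx l J x)
      + \sum_k J x l k * \tr (invmx (g' (F x)) *m dmx k g' (F x)).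
    rewrite (eq_dmx oO l g_change Ox).
    have sJT := smooth_mx_tr oO smooth_jacobian.
    rewrite (dmxM oO l (smooth_mxM oO smooth_jacobian sgF) sJT Ox).
    rewrite (dmxM oO l smooth_jacobian sgF Ox) (dmx_tr oO l J Ox) (dmx_comp l sg' Ox).
    have Gg : invmx (g x) = invmx (J x)^T *m invmx (g' (F x)) *m invmx (J x).
      rewrite inverse_change // !mulmxA mulVmx ?unitmx_tr // mul1mx -mulmxA mulmxV //.
      by rewrite mulmx1.
    rewrite Gg /= (trace_congruence _ _ Ju (gu' (FO Ox))); congr (_ + _).
    rewrite mulmx_sumr raddf_sum; apply: eq_bigr => k _ /=.
    by rewrite -scalemxAr linearZ.
  rewrite /s /s' /c; under eq_bigr do rewrite T mulrDl big_distrl /= -mulrA.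
  rewrite big_split /= -big_distrr; congr (_ + _).
  rewrite exchange_big; apply: eq_bigr => k _ /=; rewrite flux_change // [in RHS]mxE big_distrr.
  by apply: eq_bigr => l _ /=; rewrite [_^T _ _]mxE mulrA [_ * J x l k]mulrC.
have fin (a b d : R) : - (a + 2^-1 * (2 * b + d)) = - (b + a + 2^-1 * d) by field.
exact: (etrans (congr1 (fun z => - (\tr D + 2^-1 * z)) E2)
  (etrans (fin _ _ _) (congr1 (fun z => - (z + 2^-1 * s')) (esym E1)))).
Qed.

End ChartChange.

Lemma eq_quantum_integral_loc (R : realType) n (U : set 'rV[R]_n) (g A : 'rV[R]_n -> 'M[R]_n) t u v x :
  open U -> (forall y, U y -> u y = v y) -> U x ->
  quantum_integral_loc g A t u x = quantum_integral_loc g A t v x.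
Proof.
move=> oU uv Ux.
have E : contravariant_operator g (levi_civita g) A t u x = contravariant_operator g (levi_civita g) A t v x.
  by apply: (eq_divg oU _ _ Ux) => y Uy; rewrite (eq_grad oU uv Uy).
exact: (etrans (quantum_integral_locE g A t u x)
  (etrans (congr1 -%R E) (esym (quantum_integral_locE g A t v x)))).
Qed.

(** * From charts to the manifold *)

Section Manifold.
Context {R : realType} {n : nat} {M : smooth_manifold R n}.
Implicit Types (a b : atlas M) (p q : M).

Lemma chart_image_open a : open (chart_image a).
Proof. exact: image_open. Qed.

Lemma overlapP a b x : overlap a b x <-> chart_image a x /\ dom b (param a x).
Proof.
split=> [[q [qa qb] <-]|[[q qa <-] qb]]; first by split; [exists q|rewrite coordK].
by exists q => //; split=> //; rewrite coordK in qb.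
Qed.

Lemma overlap_open a b : open (overlap a b).
Proof.
have oa := @chart_image_open a.
have := @param_continuous _ _ M a; rewrite (continuous_open_subspace _ oa) => ca.
rewrite openE => x /overlapP [xa xb]; rewrite /interior.
have cx : {for x, continuous (param a)} by apply: ca; rewrite inE.
have nb : nbhs (param a x) (dom b) by exact: (open_nbhs_nbhs (conj (dom_open b) xb)).
apply: filterS (filterI (open_nbhs_nbhs (conj oa xa)) (cx _ nb)) => y [ya yb].
by apply/overlapP.
Qed.

Lemma param_transition a b x : overlap a b x -> param b (transition a b x) = param a x.
Proof. by move=> [q [qa qb] <-]; rewrite /transition /= !coordK. Qed.

Lemma transition_image a b x : overlap a b x -> chart_image b (transition a b x).
Proof. by move=> /overlapP[xa xb]; exists (param a x). Qed.

Variables g A : components M.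
Hypotheses (hg : pseudo_riemannian g) (hA : projectively_compatible g A).

Let sg a : smooth_mx_on (chart_image a) (g a). Proof. by case: hg => -[]. Qed.
Let sA a : smooth_mx_on (chart_image a) (A a). Proof. by case: hA => -[]. Qed.
Let gT a x : chart_image a x -> (g a x)^T = g a x. Proof. by case: hg => _ H /H []. Qed.
Let gu a x : chart_image a x -> g a x \in unitmx. Proof. by case: hg => _ H /H []. Qed.

(** The chart used in the definition varies with the point, whereas a second operator differentiates
    the result: this expresses it throughout the domain of one fixed chart. *)
Lemma quantum_integralE t (f : M -> R) a q : smooth_fun f -> dom a q ->
  quantum_integral g A t f q = quantum_integral_loc (g a) (A a) t (f \o param a) (Defs.coord a q).
Proof.
move=> sf qa; rewrite /quantum_integral; set c := chart_at q.
have qc : dom c q by rewrite /c /chart_at; case: cid.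
have ox : overlap a c (Defs.coord a q) by exists q.
have sub x : overlap a c x -> chart_image a x by move=> /overlapP[].
have -> : Defs.coord c q = transition a c (Defs.coord a q) by rewrite /transition /= coordK.
apply/esym.
apply: (@quantum_integral_loc_change _ _ (overlap a c) (chart_image c) (@overlap_open a c)
  (@chart_image_open c) (transition a c) _ _ (g a) (A a) (g c) (A c)) => //.
- exact: transition_smooth.
- by move=> x; exact: transition_image.
- by move=> i j; exact: smooth_subset sub (sg i j).
- by move=> i j; exact: smooth_subset sub (sA i j).
- by move=> x /sub; exact: gT.
- by move=> x /sub; exact: gu.
- by move=> x; exact: gT.
- by move=> x; exact: gu.
- by case: hg => -[_ H] _ x; exact: H.
- by case: hA => -[_ H] _ x; exact: H.
- exact: smooth_subset sub (sf a).
- by move=> x ox' /=; rewrite param_transition.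
Qed.

Lemma quantum_integrals_commute v w (f : M -> R) p : smooth_fun f ->
  quantum_integral g A v (quantum_integral g A w f) p =
  quantum_integral g A w (quantum_integral g A v f) p.
Proof.
move=> sf; rewrite /quantum_integral; set a := chart_at p.
have pa : dom a p by rewrite /a /chart_at; case: cid.
have Ux : chart_image a (Defs.coord a p) by exists p.
(* On the whole chart image, not only at p, so that locality lets the outer operator act on the
   coordinate expression. *)
have E t y : chart_image a y -> (quantum_integral g A t f \o param a) y =
    quantum_integral_loc (g a) (A a) t (f \o param a) y.
  by move=> [q qa <-] /=; rewrite coordK // (quantum_integralE t sf qa).
have oa := @chart_image_open a.
apply: (etrans (eq_quantum_integral_loc (g a) (A a) v oa (E w) Ux)).
apply: (etrans _ (esym (eq_quantum_integral_loc (g a) (A a) w oa (E v) Ux))).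
have [_ H] := hA.
apply: (quantum_integrals_loc_commute oa (@sg a) (@gT a) (@gu a) (@sA a) _ _ v w (sf a) Ux).
  by move=> x /H [].
by move=> x k i j /H [_]; apply.
Qed.

End Manifold.

Theorem theorem4 (R : realType) (n : nat) (M : smooth_manifold R n)
    (g A : components M) :
  pseudo_riemannian g ->
  projectively_compatible g A ->
  forall (v w : R) (f : M -> R), smooth_fun f ->
  forall p : M,
    commutator (quantum_integral g A v) (quantum_integral g A w) f p = 0.
Proof.
move=> hg hA v w f sf p; rewrite /commutator.
by rewrite (quantum_integrals_commute hg hA v w p sf) subrr.
Qed.
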